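(* For every $\eta_0>0$ there exists a constant $A$ depending only on $\eta_0$ such that the following holds. Let $p$ be a prime, $n\ge 2$ and $N\ge1$ integers, and $\mu$ a probability distribution on $\mathbb{F}_p$ with $\eta:=1-\max_{x\in\mathbb{F}_p}\mu(x)=\eta_0$. Let $f(x)=\sum_{i=0}^n\varepsilon_i x^i\in\mathbb{F}_p[x]$ with $\varepsilon_0,\dots,\varepsilon_n$ independent with distribution $\mu$, and let $\overline{f}$ be a uniformly random monic polynomial of degree $n$ in $\mathbb{F}_p[x]$. Then $$d_{TV}\left((N_i(f))_{1\le i\leq N},(N_i(\overline{f}))_{1\le i\leq N}\right)\le A\left(p^{-1}+n^{-\frac12}\right)N^2(\log n)^4(\log p)^2.$$
   Context: For a polynomial $g$ over a finite field, $N_i(g)$ denotes the number of distinct monic irreducible polynomials $\phi\neq x$ of degree $i$ dividing $g$ (the factor $x$ is always excluded); if $g=0$ every such $\phi$ counts. $d_{TV}(X,Y)=\sup_A|\mathbb{P}(X\in A)-\mathbb{P}(Y\in A)|$ is the total variation distance between laws. *)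

(* Defs.v *)
From HB Require Import structures.
From mathcomp Require Import all_boot all_order all_algebra.
From mathcomp Require Import finmap.
From mathcomp Require Import all_classical all_reals all_analysis.

Set Implicit Arguments.
Unset Strict Implicit.
Unset Printing Implicit Defensive.

Import Order.TTheory GRing.Theory Num.Theory.

Local Open Scope classical_set_scope.
Local Open Scope ring_scope.

(* Discrete sigma-algebras on 'I_n.+1 (hence on 'F_p) and on {poly F}, so that
   elements of these types can be values of random variables.  For a finite F
   the type {poly F} is countable, so this is also the sigma-algebra generated
   by the singletons. *)
HB.instance Definition _ (n : nat) := isPointed.Build 'I_n.+1 ord0.
HB.instance Definition _ (n : nat) :=
  @isMeasurable.Build default_measure_display 'I_n.+1
    discrete_measurable discrete_measurable0
    discrete_measurableC discrete_measurableU.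

HB.instance Definition _ (F : finFieldType) := isPointed.Build {poly F} 0.
HB.instance Definition _ (F : finFieldType) :=
  @isMeasurable.Build default_measure_display {poly F}
    discrete_measurable discrete_measurable0
    discrete_measurableC discrete_measurableU.

Definition mutually_independent (d d' : measure_display) (T : measurableType d)
    (T' : measurableType d') (R : realType) (P : probability T R)
    (I : finType) (X : I -> {RV P >-> T'}) : Prop :=
  forall (J : {set I}) (B : I -> set T'),
    (forall i, i \in J -> measurable (B i)) ->
    P (\bigcap_(i in [set` J]) (X i @^-1` B i)) =
    (\prod_(i in J) P (X i @^-1` B i))%E.

(* Meaningful for S finite and nonempty; otherwise no X satisfies it for lack
   of total mass 1. *)
Definition uniformly_distributed (d d' : measure_display)
    (T : measurableType d) (T' : measurableType d') (R : realType)
    (P : probability T R) (X : {RV P >-> T'}) (S : set T') : Prop :=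
  forall B : set T', measurable B ->
    distribution P X B = (#|` fset_set (B `&` S)|%:R / #|` fset_set S|%:R)%:E.

Definition dTV (d : measure_display) (T : measurableType d) (R : realType)
    (mu nu : set T -> \bar R) : \bar R :=
  ereal_sup [set `|mu A - nu A|%E | A in measurable].

Definition monic_of_degree (F : finFieldType) (n : nat) : set {poly F} :=
  [set g | g \is monic /\ size g = n.+1].

(* Every polynomial divides 0 for %|, so all phi count when g = 0. *)
Definition irr_divisors (F : finFieldType) (i : nat) (g : {poly F}) :
    set {poly F} :=
  [set phi | [/\ monic_of_degree i phi, irreducible_poly phi,
                 phi != 'X & phi %| g]].

(* The set counted is finite because F is, so fset_set loses nothing. *)
Definition num_irr_divisors (F : finFieldType) (i : nat) (g : {poly F}) : nat :=
  #|` fset_set (irr_divisors i g)|.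

(* The vector (N_i(g))_{1 <= i <= N}; entry i : 'I_N is N_{i+1}(g).  The
   sigma-algebra on N.-tuple nat, a product of discrete ones over countable
   types, is the full power set. *)
Definition irr_divisor_profile (F : finFieldType) (N : nat) (g : {poly F}) :
    N.-tuple nat :=
  [tuple num_irr_divisors i.+1 g | i < N].

(* Main.v *)
From HB Require Import structures.
Require Import Defs.
From mathcomp Require Import all_boot all_order all_algebra all_field.
From mathcomp Require Import finmap complex.
From mathcomp Require Import all_classical all_reals all_analysis.
From mathcomp Require Import zify ring lra.

(** Call a monic irreducible [phi <> X] bad if it divides [X^t - 1] for some
    [1 <= t <= Q], where [Q] is about [N (log n)^2 log p].  At most [Q^2]
    polynomials are bad, and by an Erdos-Littlewood-Offord bound over [F_p] each
    divides [f] with probability [O(1/p + n^(-1/2))]; this is the main error.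

    The good divisors of degree at most [N] are compared by truncated
    inclusion-exclusion, for which it suffices that
    [P(D | f) = p^(- deg D) (1 + tiny)] for each product [D] of at most
    [26 log n] good polynomials.  By Fourier inversion modulo [D] this follows if
    [sum_j ||u_j / p||^2] is large for every nonzero sequence [u_j = psi(X^j)],
    [psi] a functional on [F_p[X]/(D)].  Otherwise some long window of [u] is
    close to [0].  Hoeffding's inequality and the pigeonhole principle then give
    a nonzero [P] with coefficients in [{-1, 0, 1}], divisible by [D] modulo [p],
    which annihilates the integer lift of [u] on that window over [Z].  For a
    prime [q > 2 deg P] we have [P(X^q) = P^q] modulo [q], so [P(X^q)^k]
    multiplies the lift by a multiple of [q^k] while its norm grows by at most
    [(deg P)^k]: it annihilates the lift too.  Hence one irreducible factor
    [phi] of [D] divides [P(X^q)] for more than [deg P] primes [q <= Q]; two of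
    the powers [z^q] of a root [z] of [phi] coincide, and [phi] is bad. *)

Set Implicit Arguments.
Unset Strict Implicit.
Unset Printing Implicit Defensive.

Import Order.TTheory GRing.Theory Num.Theory.
Import numFieldNormedType.Exports.
Import ComplexField.Normc.

(** * Primes *)

(** Bad polynomials resist the argument used for good ones: for [X - 1] the sequence [u_j] may be
    constantly [1], and when [p] is far above [sqrt n] the value [f(1)] is not equidistributed. They
    are paid for by a union bound, so the factor in the theorem is essentially their number.

    Write [l], [la] for the binary logarithms of [n], [p], rounded up. The number of good divisors
    has mean [O(log N)], so truncating at order [26 l] leaves a negligible error. Then
    [deg D <= 26 N l], and the pigeonhole step wants [2^r > 2 p^(deg D)], whence [r] of order
    [N l la]; [r] suitable primes exist below [Q = 12 r l]. A window has length of order [la Q r],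
    and of order [r l] disjoint windows are needed to beat the [p^(deg D)] terms of the Fourier sum.
    All this fits once [n] exceeds a multiple of [N^4 l^8 la^4], the square of [N^2 l^4 la^2]; for
    smaller [n] the claimed bound exceeds [1]. *)

Lemma central_bin_ge M : 2 ^ M <= 'C(M.*2, M).
Proof.
elim: M => [|M IH]; first by rewrite bin0.
rewrite doubleS expnS binS.
have -> : 'C(M.*2.+1, M) = 'C(M.*2.+1, M.+1).
  by rewrite -bin_sub; [congr 'C(_, _); lia | lia].
by rewrite addnn -mul2n leq_mul2l /= binS (leq_trans IH) // leq_addl.
Qed.

(** By Legendre's formula the exponent of [q] is the sum over [k] of [2M %/ q^k - 2 (M %/ q^k)];
    each term is [0] or [1], and it vanishes once [q^k > 2M]. *)
Lemma logn_central_bin q M : prime q -> 0 < M ->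
  q ^ logn q 'C(M.*2, M) <= M.*2.
Proof.
move=> q_pr M_gt0.
have q_gt1 := prime_gt1 q_pr.
apply: leq_trans (trunc_logP q_gt1 (n := M.*2) ltac:(lia)).
rewrite leq_exp2l //.
have C_gt0 : 0 < 'C(M.*2, M) by rewrite bin_gt0; lia.
have eC : logn q (M.*2)`! = logn q 'C(M.*2, M) + (logn q M`! + logn q M`!).
  rewrite -(@bin_fact M.*2 M); last lia.
  by rewrite (_ : M.*2 - M = M); [rewrite !lognM ?muln_gt0 ?fact_gt0 | lia].
set t := trunc_log q M.*2.
have M2_gt0 : 0 < M.*2 by rewrite double_gt0.
have tM : t <= M.*2.
  exact: leq_trans (ltnW (ltn_expl t q_gt1)) (trunc_logP q_gt1 M2_gt0).
suff: logn q (M.*2)`! <= t + (logn q M`! + logn q M`!) by rewrite eC leq_add2r.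
(* Both Legendre sums are padded with zeros to a common range, to be compared term by term. *)
have E N : N <= M.*2 -> logn q N`! = \sum_(1 <= k < M.*2.+1) N %/ q ^ k.
  move=> leN; rewrite logn_fact // [RHS](@big_cat_nat _ _ _ N.+1) //=.
  rewrite [X in _ = _ + X]big_nat_cond [X in _ = _ + X]big1 ?addn0 // => k.
  rewrite andbT => /andP[ltk _].
  by apply: divn_small; apply: ltn_trans ltk _; exact: ltn_expl.
have leM : M <= M.*2 by lia.
rewrite (E _ (leqnn _)) (E _ leM).
have -> : t = \sum_(1 <= k < M.*2.+1) (k <= t).
  rewrite (@big_cat_nat _ _ _ t.+1) //=.
  rewrite [X in _ + X]big_nat_cond [X in _ + X]big1 ?addn0; last first.
    by move=> k; rewrite andbT => /andP[ltk _]; rewrite leqNgt ltk.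
  rewrite big_nat_cond (eq_bigr (fun=> 1)); last first.
    by move=> k; rewrite andbT => /andP[_]; rewrite ltnS => ->.
  by rewrite -big_nat_cond sum_nat_const_nat muln1 subn1.
rewrite -!big_split /=; rewrite big_nat_cond [leqRHS]big_nat_cond.
apply: leq_sum => k; rewrite andbT => /andP[k_gt0 _].
have qk_gt0 : 0 < q ^ k by rewrite expn_gt0 prime_gt0.
case: (leqP k t) => [_|ltk] /=; last first.
  rewrite divn_small //; exact: leq_trans (trunc_log_ltn _ q_gt1) (leq_pexp2l (prime_gt0 q_pr) ltk).
move: (q ^ k) qk_gt0 => d d_gt0.
have := divn_eq M d; have := ltn_pmod M d_gt0.
move: (M %/ d) (M %% d) => a b ltb ->.
rewrite -ltnS ltn_divLR //; nia.
Qed.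

(* Chebyshev: all prime powers dividing the central binomial coefficient
   ['C(2M, M) >= 2 ^ M] are at most [2M]. *)
Lemma many_primes r K : 0 < r -> 0 < K -> 6 * r * K <= 2 ^ K ->
  exists s : seq nat, [/\ size s = r, uniq s &
    forall q, q \in s -> [/\ prime q, 2 * r <= q & q <= 6 * r * K]].
Proof.
move=> r_gt0 K_gt0 leK.

set M := 3 * r * K.
have M_gt0 : 0 < M by rewrite !muln_gt0 r_gt0 K_gt0.
have MM : M.*2 = 6 * r * K by rewrite /M; lia.
set C := 'C(M.*2, M).
have C_gt0 : 0 < C by rewrite bin_gt0; lia.
have primesC q : q \in primes C -> prime q /\ q <= M.*2.
  rewrite mem_primes => /and3P[q_pr _ qC]; split=> //.
  rewrite (leq_trans _ (logn_central_bin q_pr M_gt0)) // -{1}(expn1 q).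
  by rewrite leq_exp2l ?prime_gt1 // logn_gt0 mem_primes q_pr C_gt0.
have leC : C <= (2 ^ K) ^ size (primes C).
  rewrite {1}(prod_prime_decomp C_gt0) prime_decompE big_map /=.
  rewrite -[size _]sum1_size expn_sum big_seq [leqRHS]big_seq.
  apply: leq_prod => q /primesC[q_pr _]; rewrite expn1.
  by rewrite (leq_trans (logn_central_bin q_pr M_gt0)) // MM.
(* [2^(3rK) <= C <= 2^(K * size (primes C))] yields [3r] primes; at most [2r] of them lie below
   [2r]. *)
have : 3 * r <= size (primes C).
  have := leq_trans (central_bin_ge M) leC.
  rewrite -expnM leq_exp2l // /M => h; nia.
set s := primes C => les.
have : r <= size (seq.filter (leq (2 * r)) s).
  have : size (seq.filter (predC (leq (2 * r))) s) <= 2 * r.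
    rewrite -[leqRHS](size_iota 0) uniq_leq_size ?filter_uniq ?primes_uniq //.
    by move=> q; rewrite mem_filter mem_iota /= -ltnNge => /andP[].
  have := count_predC (leq (2 * r)) s; rewrite !size_filter; lia.
move=> ler; exists (take r (seq.filter (leq (2 * r)) s)); split.
- by rewrite size_takel.
- by rewrite take_uniq // filter_uniq // primes_uniq.
- by move=> q /mem_take; rewrite mem_filter => /andP[? /primesC[? ?]]; rewrite -MM.
Qed.

Local Open Scope ring_scope.

(** * Integer sequences annihilated by a polynomial *)

Lemma comp_polyXn_Fp q (P : {poly 'F_q}) : prime q -> P \Po 'X^q = P ^+ q.
Proof.
move=> q_pr; have chF : q \in [pchar {poly 'F_q}].
  by rewrite (rmorph_pchar (polyC : {rmorphism 'F_q -> {poly 'F_q}}))// pchar_Fp.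
elim/poly_ind: P => [|P c IH]; first by rewrite comp_poly0 expr0n eqn0Ngt prime_gt0.
rewrite comp_polyD comp_polyM comp_polyX comp_polyC IH.
rewrite -!(pFrobenius_autE chF) rmorphD rmorphM /= !pFrobenius_autE.
congr (_ + _); rewrite -polyC_exp; congr _%:P.
by have := expf_card c; rewrite card_Fp.
Qed.

Lemma comp_polyXn_int q (P : {poly int}) : prime q ->
  exists R : {poly int}, P \Po 'X^q = P ^+ q + q%:R * R.
Proof.
move=> q_pr; pose S := P \Po 'X^q - P ^+ q.
have dS i : (q%:Z %| S`_i)%Z.
  rewrite (dvdz_pcharf (pchar_Fp q_pr)) -coef_map /=.
  by rewrite rmorphB rmorphXn /= map_comp_poly /= map_polyXn comp_polyXn_Fp // subrr coef0.
exists (map_poly (fun c : int => (c %/ q%:Z)%Z) S).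
apply/eqP; rewrite addrC -subr_eq; apply/eqP/polyP => i.
rewrite mulr_natl coefMn coef_map_id0 ?div0z // -[LHS](divzK (dS i)).
by rewrite -mulr_natr natz.
Qed.

(** The functional sending ['X^i] to [y i]. Thus [seq_pairing y ('X^j * P) = 0] says that [y]
    satisfies at index [j] the linear recurrence given by [P]. *)
Definition seq_pairing (y : nat -> int) (P : {poly int}) : int :=
  \sum_(i < size P) P`_i * y i.

Lemma seq_pairing_widen y (P : {poly int}) n : (size P <= n)%N ->
  seq_pairing y P = \sum_(i < n) P`_i * y i.
Proof.
move=> leP; rewrite /seq_pairing -!(big_mkord xpredT (fun i => P`_i * y i)).
rewrite [RHS](@big_cat_nat _ _ _ (size P)) //= [X in _ = _ + X]big_nat_cond.
rewrite [X in _ = _ + X]big1 ?addr0 // => i; rewrite andbT => /andP[le _].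
by rewrite nth_default ?mul0r.
Qed.

Lemma seq_pairing_is_linear y : linear (seq_pairing y : {poly int} -> int^o).
Proof.
move=> a P Q; pose n := maxn (size (a *: P + Q)) (maxn (size P) (size Q)).
rewrite !(@seq_pairing_widen _ _ n) ?leq_max ?leqnn ?orbT //.
rewrite -[a *: \sum_(i < n) _]/(a * _) mulr_sumr -big_split /=; apply: eq_bigr => i _.
by rewrite coefD coefZ mulrDl mulrA.
Qed.

HB.instance Definition _ y :=
  GRing.isLinear.Build int {poly int} int^o _ (seq_pairing y) (seq_pairing_is_linear y).

Lemma seq_pairingZ y a (P : {poly int}) :
  seq_pairing y (a *: P) = a * seq_pairing y P.
Proof. by have := seq_pairing_is_linear y a P 0; rewrite !addr0 raddf0 addr0. Qed.

Lemma seq_pairingXn y i : seq_pairing y 'X^i = y i.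
Proof.
rewrite /seq_pairing size_polyXn big_ord_recr /= coefXn eqxx mul1r big1 ?add0r // => j _.
by rewrite coefXn ltn_eqF ?mul0r.
Qed.

Lemma polyE_sum (P : {poly int}) : P = \sum_(i < size P) P`_i *: 'X^i.
Proof. by rewrite -poly_def coefK. Qed.

Lemma seq_pairing_mull y P S :
  seq_pairing y (P * S) = \sum_(i < size P) P`_i * seq_pairing y ('X^i * S).
Proof.
rewrite {1}[P]polyE_sum mulr_suml raddf_sum; apply: eq_bigr => i _.
by rewrite -scalerAl /= seq_pairingZ.
Qed.

Lemma comp_polyXnE (P : {poly int}) q : P \Po 'X^q = \sum_(i < size P) P`_i *: 'X^(q * i).
Proof. by rewrite comp_polyE; apply: eq_bigr => i _; rewrite -exprM. Qed.

(** [P \Po 'X^q] has at most [r] nonzero coefficients, none above [1] in absolute value, so applying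
    it multiplies the sup norm by at most [r], however large [q] is. *)
Lemma seq_pairing_bound (y : nat -> int) (P : {poly int}) q r B t j :
  (forall i, `|P`_i| <= 1) -> (size P <= r)%N ->
  (forall i, `|y i| <= B%:R) ->
  `|seq_pairing y ('X^j * (P \Po 'X^q) ^+ t)| <= (r ^ t * B)%:R.
Proof.
move=> P1 szP yB; elim: t j => [|t IH] j.
  by rewrite expr0 mulr1 seq_pairingXn expn0 mul1n.
rewrite exprS mulrA comp_polyXnE mulr_sumr mulr_suml raddf_sum.
apply: (le_trans (ler_norm_sum _ _ _)).
apply: (@le_trans _ _ (\sum_(i < size P) (r ^ t * B)%:R)).
  apply: ler_sum => i _; rewrite -scalerAr -scalerAl /= seq_pairingZ -exprD.
  rewrite normrM -[leRHS]mul1r -comp_polyXnE.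
  by apply: ler_pM.
rewrite sumr_const card_ord -[_ *+ _]mulr_natl -natrM ler_nat expnS -mulnA.
by rewrite leq_mul2r szP orbT.
Qed.

(* Modulo [q] the polynomial [P(X^q)] is [P^q], so [P(X^q)^k] acts on a
   sequence killed by [P] as a multiple of [q^k], while being too small for a
   nonzero one. *)
Lemma seq_pairing_descent (y : nat -> int) (P : {poly int}) q r B k j0 w :
  prime q -> (2 * r <= q)%N -> (0 < r)%N -> (B < 2 ^ k)%N ->
  (forall i, `|P`_i| <= 1) -> (size P <= r)%N ->
  (forall i, `|y i| <= B%:R) ->
  (forall j, (j0 <= j < j0 + w)%N -> seq_pairing y ('X^j * P) = 0) ->
  forall j, (j0 <= j)%N -> (j + k * (q * r) <= j0 + w)%N ->
  seq_pairing y ('X^j * (P \Po 'X^q) ^+ k) = 0.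
Proof.
move=> q_pr rq r_gt0 Bk P1 szP yB yP j j0j jw.
have q_gt0 := prime_gt0 q_pr.
have [R eR] := comp_polyXn_int P q_pr.
have [P0|nzP] := eqVneq P 0.
  case: k Bk jw => [|k] Bk jw.
    move: (yB j); have -> : B = 0%N by lia.
    by rewrite normr_le0 expr0 mulr1 seq_pairingXn => /eqP.
  by rewrite P0 comp_poly0 exprS mul0r mulr0 raddf0.
(* Since [P \Po 'X^q - q R = P ^+ q], the difference of the [k]-th powers of [P \Po 'X^q] and [q R]
   is a multiple of [P]; [G] is the quotient. *)
pose G := P ^+ q.-1 * \sum_(i < k) (P \Po 'X^q) ^+ (k.-1 - i) * (q%:R * R) ^+ i.
have eG : G * P = (P \Po 'X^q) ^+ k - (q%:R * R) ^+ k.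
  have ePq : P ^+ q = P ^+ q.-1 * P by rewrite -exprSr prednK.
  by rewrite subrXX {1}eR addrK ePq /G mulrAC.
have szX : (size (P \Po 'X^q) <= (q * r.-1).+1)%N.
  have := size_comp_poly P 'X^q; rewrite size_polyXn /= => szPX.
  have : ((size P).-1 * q <= r.-1 * q)%N by rewrite leq_mul2r; lia.
  by rewrite -szPX mulnC => h; rewrite (leq_trans (leqSpred _)) // ltnS.
have sz_exp (S : {poly int}) a i : (size S <= a.+1)%N -> (size (S ^+ i) <= (a * i).+1)%N.
  move=> szS; apply: leq_trans (size_poly_exp_leq S i) _.
  rewrite ltnS leq_mul2r; lia.
have szqR : (size (q%:R * R)%R <= (q * r.-1).+1)%N.
  have -> : q%:R * R = P \Po 'X^q - P ^+ q by rewrite eR addrAC subrr add0r.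
  rewrite (leq_trans (size_polyD _ _)) // geq_max szX size_polyN.
  by rewrite mulnC sz_exp // (leq_trans szP) // prednK.
(* This keeps every shift at which [yP] is used inside the window. *)
have szG : (size G <= k * (q * r))%N.
  have [->|nzG] := eqVneq G 0; first by rewrite size_poly0.
  have [k0|k_gt0] := posnP k.
    by move: nzG; rewrite /G k0 big_ord0 mulr0 eqxx.
  have : (size (G * P)%R <= (q * r.-1 * k).+1)%N.
    rewrite eG (leq_trans (size_polyD _ _)) // size_polyN geq_max.
    by rewrite !sz_exp.
  rewrite size_mul //; have : (0 < size P)%N by rewrite size_poly_gt0.
  move: (size G) (size P) => a b b0 h; nia.
have LGP : seq_pairing y ('X^j * G * P) = 0.
  rewrite -mulrA mulrCA seq_pairing_mull big1 // => i _.
  rewrite mulrA -exprD yP ?mulr0 //.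
  by have := ltn_ord i; lia.
have eL : seq_pairing y ('X^j * (P \Po 'X^q) ^+ k) =
    (q ^ k)%:R * seq_pairing y ('X^j * R ^+ k).
  move/eqP: LGP; rewrite -mulrA eG mulrBr raddfB subr_eq0 => /eqP ->.
  by rewrite exprMn -natrX mulrCA mulr_natl raddfMn mulr_natl.
have := seq_pairing_bound q k j P1 szP yB; rewrite eL.
set z := seq_pairing y _.
have [->|nz] := eqVneq z 0; first by rewrite mulr0.
(* A nonzero integer [z] has [|z| >= 1], which would give [q^k <= r^k B < (2r)^k <= q^k]. *)
rewrite normrM => h; exfalso.
have : (q ^ k)%:R * 1 <= (r ^ k * B)%:R :> int.
  apply: le_trans h; rewrite ger0_norm ?ler0n // ler_wpM2l ?ler0n //.
  by rewrite -[1]/(1%:Z) -gtz0_ge1 normr_gt0.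
rewrite mulr1 ler_nat leqNgt => /negP; apply.
apply: leq_trans (_ : (2 * r) ^ k <= _)%N; last by case: (k) => // k'; rewrite leq_exp2r.
by rewrite expnMn mulnC ltn_pmul2r // expn_gt0 r_gt0.
Qed.

(** * Divisors forced by a small window *)

Lemma irreducible_coprime (F : fieldType) (phi g : {poly F}) :
  irreducible_poly phi -> ~~ (phi %| g) -> coprimep phi g.
Proof. by move=> irr; rewrite irreducible_poly_coprime. Qed.

Lemma irreducible_dvdM (F : fieldType) (phi g h : {poly F}) :
  irreducible_poly phi -> phi %| g * h -> (phi %| g) || (phi %| h).
Proof.
move=> irr; have [//|/(irreducible_coprime irr) co] := boolP (phi %| g).
by rewrite (Gauss_dvdpr _ co).
Qed.

Lemma irreducible_dvdX (F : fieldType) (phi g : {poly F}) k :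
  irreducible_poly phi -> phi %| g ^+ k -> phi %| g.
Proof.
move=> irr; elim: k => [|k IH]; last by rewrite exprS => /(irreducible_dvdM irr)/orP[|/IH].
by rewrite expr0 dvdp1 => /eqP h; move: irr.1; rewrite h.
Qed.

Lemma irreducible_divisor (F : fieldType) (g : {poly F}) : (1 < size g)%N ->
  exists2 phi, irreducible_poly phi & phi %| g.
Proof.
have [n] := ubnP (size g); elim: n g => // n IH g leg szg.
have [irr|] := pselect (irreducible_poly g); first by exists g.
move/not_andP => [//|/existsNP[d /not_implyP[szd /not_implyP[dg ndg]]]].
have nzg : g != 0 by rewrite -size_poly_gt0; lia.
have nzd : d != 0 by apply: contraNneq nzg => d0; move: dg; rewrite d0 dvd0p.
have ltd : (size d < size g)%N.
  by rewrite ltn_neqAle dvdp_leq // andbT; apply/negP => /eqP e; apply: ndg; rewrite -dvdp_size_eqp // e.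
have szd1 : (1 < size d)%N.
  by rewrite ltn_neqAle eq_sym szd size_poly_gt0.
have [phi irr dphi] := IH d (leq_trans ltd leg) szd1.
by exists phi => //; exact: dvdp_trans dg.
Qed.

(* Any nonzero functional on [F[X]] has an annihilator ideal; being principal
   it provides one divisor for all its elements. *)
Lemma annihilator_irreducible (F : fieldType) (psi : {linear {poly F} -> F^o})
    (D : {poly F}) : D != 0 -> (forall g, psi (g * D) = 0) ->
  (exists g, psi g != 0) ->
  exists phi, [/\ irreducible_poly phi, phi %| D &
    forall S, (forall g, psi (g * S) = 0) -> phi %| S].
Proof.
move=> nzD annD [g0 g0N].
have [E [nzE annE dvdE]] : exists E, [/\ E != 0, forall g, psi (g * E) = 0 &
    forall S, (forall g, psi (g * S) = 0) -> E %| S].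
  have [n] := ubnP (size D); elim: n D nzD annD => // n IH D nzD annD leD.
  have [h|/existsNP[S /not_implyP[annS /negP nDS]]] :=
    pselect (forall S, (forall g, psi (g * S) = 0) -> D %| S); first by exists D.
  apply: (IH (S %% D)); last by rewrite -ltnS (leq_trans _ leD) // ltnS ltn_modp.
    by move: nDS; rewrite /dvdp.
  move=> g; have /(congr1 (fun T => psi (g * T))) := divp_eq S D.
  by rewrite annS mulrDr raddfD /= mulrA annD add0r => <-.
(* If the generator [E] of the annihilator were constant, [psi] would vanish identically. *)
have szE : (1 < size E)%N.
  rewrite ltn_neqAle size_poly_gt0 nzE andbT; apply: contraNN g0N => /eqP/esym/eqP.
  rewrite size_poly_eq1 => /eqpP[[a b]] /= /andP[nza nzb] e.
  rewrite -[g0]mulr1 -[1](scalerK nzb) -e scalerA -scalerAr linearZ /= annE.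
  by rewrite scaler0.
have [phi irr dphi] := irreducible_divisor szE; exists phi; split=> //.
  exact: dvdp_trans (dvdE _ annD).
by move=> S /dvdE; exact: dvdp_trans.
Qed.

Lemma irreducible_root (F : fieldType) (phi : {poly F}) : irreducible_poly phi ->
  exists2 L : fieldExtType F, \dim {:L} = (size phi).-1 &
  exists z : L, forall g, (phi %| g) = root (map_poly (in_alg L) g) z.
Proof.
move=> irr; have [L dimL [z rz _]] := irredp_FAdjoin irr; exists L => //; exists z => g.
apply/idP/idP => [dg|]; first by apply: root_dvdp rz; rewrite dvdp_map.
apply: contraTT => /(irreducible_coprime irr).
rewrite -(coprimep_map (in_alg L)) => /coprimep_root /(_ rz).
by rewrite rootE.
Qed.

Lemma dvdp_XnB1_of_comp (F : fieldType) (phi P : {poly F}) (s : seq nat) Q :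
  irreducible_poly phi -> ~~ (phi %| 'X) -> P != 0 -> (size P <= size s)%N ->
  uniq s -> (forall q, q \in s -> q <= Q)%N ->
  (forall q, q \in s -> phi %| P \Po 'X^q) ->
  exists t, (0 < t <= Q)%N /\ phi %| 'X^t - 1.
Proof.
move=> irr nX nzP szP us leQ dP.
have [L _ [z zP]] := irreducible_root irr.
have nzz : z != 0 by apply: contraNneq nX => z0; rewrite zP z0 map_polyX rootX.
have /(uniqPn 0) [i [j [ltij ltj]]] : ~~ uniq [seq z ^+ q | q <- s].
  apply/negP => uz; have := max_poly_roots (p := map_poly (in_alg L) P) _ _ uz.
  rewrite map_poly_eq0 nzP size_map_poly size_map ltnNge szP => /(_ isT) h.
  suff : false by []. apply: h; apply/allP => _ /mapP[q qs ->].
  have := dP q qs; rewrite zP map_comp_poly map_polyXn.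
  by rewrite rootE horner_comp hornerXn -rootE.
move: ltj; rewrite size_map => ltj.
have lti := ltn_trans ltij ltj.
rewrite !(nth_map 0%N) // => eij.
have nij : nth 0%N s i != nth 0%N s j by rewrite nth_uniq // ltn_eqF.
have main a b : (a < b)%N -> b \in s -> z ^+ a = z ^+ b ->
    exists t, (0 < t <= Q)%N /\ phi %| 'X^t - 1.
  move=> ab bs e; exists (b - a)%N; split; first by have := leQ b bs; lia.
  rewrite zP rmorphB /= map_polyXn rmorph1 rootE !hornerE subr_eq0.
  have nza : z ^+ a != 0 by rewrite expf_neq0.
  by rewrite -(inj_eq (mulIf nza)) mul1r -exprD subnK 1?ltnW // -e.
have [lt|gt|e] := ltngtP (nth 0%N s i) (nth 0%N s j); last by rewrite e eqxx in nij.
- by apply: (main _ _ lt) => //; rewrite mem_nth.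
- by apply: (main _ _ gt) => //; rewrite mem_nth.
Qed.

(** The representative in [[- p / 2, p / 2)]: its absolute value over [p] is the distance from
    [x / p] to the nearest integer. *)
Definition centered_lift p (x : 'F_p) : int :=
  if (2 * x < p)%N then (x : nat)%:Z else (x : nat)%:Z - p%:Z.

Lemma centered_liftK p (x : 'F_p) : prime p -> (centered_lift x)%:~R = x.
Proof.
move=> p_pr; rewrite /centered_lift; case: ifP => _; rewrite ?rmorphB /= -!pmulrn.
  by rewrite natr_Zp.
by rewrite natr_Zp pchar_Fp_0 // subr0.
Qed.

Lemma centered_lift_bound p (x : 'F_p) : prime p -> 2 * `|centered_lift x| <= p%:Z.
Proof.
move=> p_pr; have : (x < p)%N by rewrite -[ltnRHS](Fp_cast p_pr) ltn_ord.
rewrite /centered_lift; case: ifP; lia.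
Qed.

Lemma seq_pairing_modp p (psi : {linear {poly 'F_p} -> ('F_p)^o}) (y : nat -> int) S :
  (forall i, (y i)%:~R = psi 'X^i) ->
  (seq_pairing y S)%:~R = psi (map_poly intr S).
Proof.
move=> yE; rewrite /seq_pairing rmorph_sum [in RHS](polyE_sum S) rmorph_sum /= raddf_sum.
apply: eq_bigr => i _; rewrite /= rmorphM /= yE map_polyZ /= map_polyXn.
by rewrite linearZ.
Qed.

(** The lifts are below [p <= 2^l] in absolute value, so [l]-th powers suffice in the descent. For
    every [q] in [s] the polynomial ['X^j0 * P(X^q)^l] lies in the annihilator ideal of [psi]; hence
    a single [phi], chosen before [q], divides them all. *)
Lemma window_relation_divisor p (psi : {linear {poly 'F_p} -> ('F_p)^o})
    (D : {poly 'F_p}) (P : {poly int}) (s : seq nat) r Q l j0 w :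
  prime p -> (p <= 2 ^ l)%N -> D != 0 -> (forall g, psi (g * D) = 0) ->
  (exists g, psi g != 0) ->
  P != 0 -> (forall i, `|P`_i| <= 1) -> (size P <= r)%N ->
  uniq s -> size s = r -> (forall q, q \in s -> [/\ prime q, 2 * r <= q & q <= Q])%N ->
  (size D + l * (Q * r) <= w)%N ->
  (forall j, (j0 <= j < j0 + w)%N ->
     seq_pairing (fun i => centered_lift (psi 'X^i)) ('X^j * P) = 0) ->
  exists phi, [/\ irreducible_poly phi, phi %| D &
    phi %| 'X \/ exists t, (0 < t <= Q)%N /\ phi %| 'X^t - 1].
Proof.
move=> p_pr pl nzD annD psiN nzP P1 szP us szs sP lew yP.
have [phi [irr phiD phiS]] := annihilator_irreducible nzD annD psiN.
exists phi; split=> //; have [|nX] := boolP (phi %| 'X); [by left | right].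
have r_gt0 : (0 < r)%N by rewrite (leq_trans _ szP) // size_poly_gt0.
pose Pb := map_poly (intr : int -> 'F_p) P.
(* The leading coefficient is [1] or [-1], so it survives reduction modulo [p]. *)
have nzPb : Pb != 0.
  have : (`|lead_coef P| <= 1) && (lead_coef P != 0) by rewrite P1 lead_coef_eq0.
  move=> /andP[h1 h2]; apply/eqP => /(congr1 (coefp (size P).-1)).
  rewrite /= coef0 coef_map -lead_coefE /=.
  have [->|->] : lead_coef P = 1 \/ lead_coef P = -1 by lia.
    by move/eqP; rewrite oner_eq0.
  by move/eqP; rewrite rmorphN /= oppr_eq0 oner_eq0.
apply: (dvdp_XnB1_of_comp irr nX nzPb _ us) => [|q /sP[]//|q /sP[q_pr rq qQ]].
  by rewrite szs (leq_trans (size_poly _ _)).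
(* The factor ['X^j0] moves the relation into the window and is coprime to [phi]. *)
suff : phi %| 'X^j0 * (Pb \Po 'X^q) ^+ l.
  case/(irreducible_dvdM irr)/orP; last exact: irreducible_dvdX.
  by move/(irreducible_dvdX irr); rewrite (negPf nX).
apply: phiS => g.
have p_gt0 := prime_gt0 p_pr.
have yE i : (centered_lift (psi 'X^i))%:~R = psi 'X^i by rewrite centered_liftK.
(* Multipliers matter only modulo [D], so [size D] consecutive shifts suffice. *)
have base j : (j0 <= j < j0 + size D)%N -> psi ('X^j * (Pb \Po 'X^q) ^+ l) = 0.
  move=> hj.
  have -> : 'X^j * (Pb \Po 'X^q) ^+ l = map_poly intr ('X^j * (P \Po 'X^q) ^+ l).
    by rewrite rmorphM !rmorphXn /= map_polyX map_comp_poly /= map_polyXn.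
  rewrite -(seq_pairing_modp _ yE) (seq_pairing_descent (r := r) (B := p.-1) (j0 := j0) (w := w)) //.
  - by rewrite prednK.
  - move=> i; have := centered_lift_bound (psi 'X^i) p_pr.
    by rewrite natz; have := prime_gt1 p_pr; lia.
  - by case/andP: hj.
  - suff : (l * (q * r) <= l * (Q * r))%N by lia.
    by rewrite leq_mul2l leq_mul2r qQ !orbT.
rewrite (divp_eq g D) mulrDl raddfD /= mulrAC annD add0r.
set h := g %% D; have szh : (size h < size D)%N by rewrite ltn_modp.
rewrite -(coefK h) poly_def mulr_suml raddf_sum big1 // => i _.
rewrite -scalerAl /= linearZ /= mulrA -exprD base ?scaler0 //.
have lti := leq_trans (ltn_ord i) (ltnW szh).
by rewrite leq_addl addnC ltn_add2l lti.
Qed.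

(** * Counting irreducible polynomials *)

Lemma irreducible_monic_coprime (F : fieldType) (phi psi : {poly F}) :
  irreducible_poly phi -> irreducible_poly psi -> phi \is monic -> psi \is monic ->
  phi != psi -> coprimep phi psi.
Proof.
move=> irrf irrg mf mg; apply: contraNT => nco.
have : phi %| psi by apply: contraNT nco; exact: irreducible_coprime.
move/(irredp_XsubCP irrg) => [h|]; last by rewrite eqp_monic.
by move: irrf.1; move: h; rewrite -size_poly_eq1 => /eqP ->.
Qed.

Lemma prod_irreducible_coprime (F : fieldType) (phi : {poly F}) (s : seq {poly F}) :
  irreducible_poly phi -> phi \is monic ->
  (forall psi, psi \in s -> psi \is monic /\ irreducible_poly psi) ->
  phi \notin s -> coprimep phi (\prod_(psi <- s) psi).
Proof.
move=> irrf mf; elim: s => [|psi s IH] sP; first by rewrite big_nil coprimep1.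
rewrite inE negb_or => /andP[ne nin]; rewrite big_cons coprimepMr.
have [mpsi ipsi] := sP psi (mem_head _ _).
rewrite irreducible_monic_coprime //= IH // => g gs.
by apply: sP; rewrite inE gs orbT.
Qed.

Lemma prod_irreducible_dvdp (F : fieldType) (s : seq {poly F}) (g : {poly F}) :
  uniq s -> (forall phi, phi \in s -> phi \is monic /\ irreducible_poly phi) ->
  (\prod_(phi <- s) phi %| g) = all (fun phi => phi %| g) s.
Proof.
elim: s => [|phi s IH] /=; first by rewrite big_nil dvd1p.
move=> /andP[nin us] sP; have [mf irrf] := sP phi (mem_head _ _).
have sP' psi : psi \in s -> psi \is monic /\ irreducible_poly psi.
  by move=> h; apply: sP; rewrite inE h orbT.
by rewrite big_cons Gauss_dvdp ?IH // prod_irreducible_coprime.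
Qed.

Lemma sum_deg_irreducible_dvdp (F : fieldType) (s : seq {poly F}) (g : {poly F}) :
  uniq s -> (forall phi, phi \in s -> phi \is monic /\ irreducible_poly phi) ->
  g != 0 -> (forall phi, phi \in s -> phi %| g) ->
  (\sum_(phi <- s) (size phi).-1 <= (size g).-1)%N.
Proof.
move=> us sP nzg sg.
have : \prod_(phi <- s) phi %| g by rewrite prod_irreducible_dvdp //; apply/allP.
move/(dvdp_leq nzg) => /(leq_sub2r 1); rewrite !subn1; apply: leq_trans.
rewrite size_prod_seq; last first.
  by move=> phi /sP [mf _]; exact: monic_neq0.
have -> : (\sum_(i <- s) size i = \sum_(i <- s) (size i).-1 + size s)%N.
  rewrite -sum1_size -big_split /=; apply: eq_big_seq => phi /sP[_ [h _]].
  by rewrite addn1 prednK ?(ltnW h).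
by rewrite subSn ?leq_addl //= addnK.
Qed.

Lemma irreducible_dvdp_Xcard (F : finFieldType) (phi : {poly F}) :
  irreducible_poly phi -> phi %| 'X^(#|F| ^ (size phi).-1) - 'X.
Proof.
move=> irr; have [L dimL zP] := irreducible_root irr.
case: zP => z ->; rewrite rmorphB /= map_polyXn map_polyX rootE !hornerE -dimL.
by rewrite subr_eq0 -Fermat's_little_theorem memvf.
Qed.

(** All of them divide [X^(q^i) - X] with [q = #|F|], and the degrees of distinct ones add up. *)
Lemma count_irreducible (F : finFieldType) (s : seq {poly F}) i : (0 < i)%N ->
  uniq s -> (forall phi, phi \in s -> [/\ phi \is monic, irreducible_poly phi & size phi = i.+1]) ->
  (i * size s <= #|F| ^ i)%N.
Proof.
move=> i_gt0 us sP; pose g : {poly F} := 'X^(#|F| ^ i) - 'X.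
have szg : size g = (#|F| ^ i).+1.
  rewrite size_polyDl ?size_polyXn // size_polyN size_polyX ltnS.
  by rewrite -[ltnLHS](expn0 #|F|) ltn_exp2l // finNzRing_gt1.
have nzg : g != 0 by rewrite -size_poly_gt0 szg.
have := @sum_deg_irreducible_dvdp F s g us _ nzg.
rewrite szg /= => h; have -> : (i * size s = \sum_(j <- s) i)%N by rewrite big_const_seq count_predT iter_addn_0.
have -> : (\sum_(j <- s) i = \sum_(phi <- s) (size phi).-1)%N.
  by apply: eq_big_seq => phi /sP[_ _ ->].
apply: h => phi /sP[mf irr szf] //.
by have := irreducible_dvdp_Xcard irr; rewrite szf.
Qed.

Definition irreducibles (F : finFieldType) (N : nat) : seq {poly F} :=
  undup [seq phi <- [seq val q | q : {poly_N.+1 F}] |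
     [&& phi \is monic, `[< irreducible_poly phi >] & phi != 'X]].

Lemma mem_irreducibles (F : finFieldType) N (phi : {poly F}) :
  reflect [/\ phi \is monic, irreducible_poly phi, phi != 'X & (size phi <= N.+1)%N]
    (phi \in irreducibles F N).
Proof.
rewrite mem_undup mem_filter; apply: (iffP andP) => [[/and3P[mf /asboolP irr nX]]|[mf irr nX szf]].
  by case/mapP => q _ e; split=> //; rewrite e; exact: size_npoly.
split; first by apply/and3P; split=> //; apply/asboolP.
by apply/mapP; exists (Sub phi szf) => //; rewrite ?mem_enum ?SubK.
Qed.

Lemma irreducible_ndvdXn (F : finFieldType) N (phi : {poly F}) j :
  phi \in irreducibles F N -> ~~ (phi %| 'X^j).
Proof.
move=> /mem_irreducibles[mf irr nX _]; apply: contra nX => /(irreducible_dvdX irr) dX.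
have irrX : irreducible_poly ('X : {poly F}) by rewrite -['X]subr0; exact: irredp_XsubC.
have [h|h] := irredp_XsubCP irrX dX.
  by move: irr.1; move: h; rewrite -size_poly_eq1 => /eqP ->.
by rewrite -eqp_monic // monicX.
Qed.

Lemma irreducibles_uniq (F : finFieldType) N : uniq (irreducibles F N).
Proof. exact: undup_uniq. Qed.

(** By [count_irreducible], degree [i] contributes at most [q^i / i] terms, each [q^(- i)]. The sum
    on the left dominates the sum of the inclusion weights of the good divisors. *)
Lemma sum_irreducibles_inv (R : realFieldType) (F : finFieldType) N :
  \sum_(phi <- irreducibles F N) (#|F| ^ (size phi).-1)%:R^-1 <=
  \sum_(1 <= i < N.+1) i%:R^-1 :> R.
Proof.
set G := irreducibles F N; pose q : nat := #|F|.
have -> : \sum_(phi <- G) (q ^ (size phi).-1)%:R^-1 =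
  \sum_(1 <= i < N.+1) \sum_(phi <- G | (size phi).-1 == i) (q ^ i)%:R^-1 :> R.
  rewrite (exchange_big_dep xpredT) //=; apply: eq_big_seq => phi /mem_irreducibles[_ irr _ szf].
  rewrite (big_rem (size phi).-1) /=; last by rewrite mem_index_iota; move: irr.1 szf; case: (size phi) => [|[|k]].
  rewrite eqxx big1_seq ?addr0 // => i /andP[/eqP <-].
  by rewrite mem_rem_uniqF ?iota_uniq.
rewrite big_nat_cond [leRHS]big_nat_cond; apply: ler_sum => i; rewrite andbT => /andP[i_gt0 _].
rewrite -big_filter big_const_seq count_predT iter_addr_0 -[_ *+ _]mulr_natr.
have q_gt0 : 0 < (q ^ i)%:R :> R by rewrite ltr0n expn_gt0 ltnW ?finNzRing_gt1.
rewrite ler_pdivrMl // ler_pdivlMr ?ltr0n // -natrM ler_nat mulnC.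
apply: count_irreducible => //; first by rewrite filter_uniq ?irreducibles_uniq.
move=> phi; rewrite mem_filter => /andP[/eqP e /mem_irreducibles[mf irr _ _]].
by split=> //; rewrite -e prednK ?(ltnW irr.1).
Qed.

(** For irreducible [phi] not dividing ['X]: the class of ['X] modulo [phi] has multiplicative order
    at most [H]. *)
Definition low_order (F : fieldType) H (phi : {poly F}) : bool :=
  has (fun t => phi %| 'X^t - 1) (iota 1 H).

(** Each of the [H] polynomials ['X^t - 1] has at most [t <= H] distinct monic irreducible
    factors. *)
Lemma count_low_order (F : finFieldType) N H :
  (count (low_order H) (irreducibles F N) <= H * H)%N.
Proof.
rewrite /low_order; set G := irreducibles F N.
suff main s : {subset s <= iota 1 H} ->
    (count (fun phi : {poly F} => has (fun t => phi %| 'X^t - 1)%R s) G <= size s * H)%N.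
  by rewrite (leq_trans (main _ _)) ?size_iota.
elim: s => [|t s IH] sH; first by rewrite /= count_pred0.
have sH' : {subset s <= iota 1 H} by move=> x xs; apply: sH; rewrite inE xs orbT.
have tH : (1 <= t < 1 + H)%N by rewrite -mem_iota sH ?mem_head.
rewrite /= mulSn (leq_trans _ (leq_add (_ : count (fun phi : {poly F} => phi %| 'X^t - 1)%R G <= H) (IH sH')))%N //.
  by rewrite -count_predUI leq_addr.
rewrite -size_filter.
have sztm : size ('X^t - 1 : {poly F}) = t.+1.
  by rewrite size_polyDl ?size_polyXn // size_polyN size_poly1; case/andP: tH.
have nz : ('X^t - 1 : {poly F}) != 0 by rewrite -size_poly_gt0 sztm.
have := @sum_deg_irreducible_dvdp F [seq phi <- G | phi %| 'X^t - 1] _ _ _ nz.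
rewrite sztm /= => h; apply: leq_trans (_ : t <= H)%N; last by case/andP: tH.
apply: leq_trans (h _ _ _).
- rewrite -sum1_size big_seq [leqRHS]big_seq; apply: leq_sum => phi.
  by rewrite mem_filter => /andP[_ /mem_irreducibles[_ irr _ _]]; move: irr.1; case: (size phi) => [|[|k]].
- by rewrite filter_uniq ?irreducibles_uniq.
- by move=> phi; rewrite mem_filter => /andP[_ /mem_irreducibles[]].
- by move=> phi; rewrite mem_filter => /andP[].
Qed.

(** * Real inequalities *)

(** With [y = x / 2], the mean value theorem gives [sin y = y cos c] for some [0 <= c <= y]. Then
    [sin x = 2 cos y sin y = (2 cos y cos c) y], and [2 cos y cos c >= 2 cos^2 y = 1 + cos x >=
    1]. *)
Lemma sin_ge_half (R : realType) (x : R) : 0 <= x <= pi / 2 -> x / 2 <= sin x.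
Proof.
move=> /andP[x0 xpi]; set y := x / 2.
have y0 : 0 <= y by rewrite divr_ge0.
have pi0 := pi_gt0 R.
have [c /[!in_itv]/= /andP[c0 cy] sinE] :
    exists2 c, c \in `[0, y]%R & sin y - sin 0 = cos c * (y - 0).
  apply: (@MVT_segment _ sin cos) => //.
  by apply: continuous_subspaceT => z; exact: continuous_sin.
rewrite sin0 !subr0 in sinE.
have ypi : y <= pi by rewrite /y; lra.
have cyE : cos y <= cos c.
  have [->//|nyc] := eqVneq y c.
  apply: ltW; rewrite ltr_cos ?in_itv /=.
  - by rewrite lt_neqAle eq_sym nyc.
  - by rewrite c0 (le_trans cy).
  - by rewrite y0.
have cosy0 : 0 <= cos y by apply: cos_ge0_pihalf; apply/andP; rewrite /y; split; lra.
have cosx0 : 0 <= cos x.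
  by apply: cos_ge0_pihalf; rewrite xpi andbT (le_trans _ x0) // oppr_le0 divr_ge0 // ltW.
have xE : x = y *+ 2 by rewrite /y -mulr_natr; field.
have cosxE : cos x = cos y ^+ 2 *+ 2 - 1 by rewrite {1}xE cos_mulr2n.
have sinxE : sin x = (cos y * sin y) *+ 2 by rewrite {1}xE sin_mulr2n.
have h : 1 <= 2 * (cos y * cos c).
  have : cos y * cos y <= cos y * cos c by rewrite ler_wpM2l.
  by rewrite cosxE -mulr_natr expr2 in cosx0; lra.
rewrite sinxE sinE -mulr_natr -/y.
have := ler_wpM2r y0 h; lra.
Qed.

(** [1 - cos (2 pi t) = 2 sin^2 (pi t)], and [sin (pi |t|) >= pi |t| / 2 >= |t|]. *)
Lemma one_sub_cos_ge (R : realType) (t : R) : `|t| <= 1 / 2 ->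
  2 * t ^+ 2 <= 1 - cos (2 * pi * t).
Proof.
move=> t1; have pi2 := pi_ge2 R; have t0 := normr_ge0 t.
set u := `|t|.
have -> : cos (2 * pi * t) = cos ((pi * u) *+ 2).
  rewrite -[LHS]cos_norm -mulrA normrM (ger0_norm (_ : 0 <= 2)) // normrM.
  by rewrite (ger0_norm (pi_ge0 R)) mulr_natl.
have -> : t ^+ 2 = u ^+ 2 by rewrite real_normK ?num_real.
have pu : 0 <= pi * u <= pi / 2 by apply/andP; split; rewrite /u; nra.
have := sin_ge_half pu; rewrite cos_mulr2n -mulr_natr cos2sin2.
have : 2 * u <= pi * u by rewrite ler_wpM2r.
rewrite /u; nra.
Qed.

(** For [|y| <= 1/2] this follows from [exp z <= 1 / (1 - z)]. It passes from [y / 2] to [y] because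
    [cosh y = 2 cosh^2 (y/2) - 1 <= cosh^4 (y/2)], while the right side is exactly raised to the
    fourth power. *)
Lemma cosh_le_exp_sqr (R : realType) (x : R) :
  expR x + expR (- x) <= 2 * expR (2 * x ^+ 2).
Proof.
pose ch (y : R) := (expR y + expR (- y)) / 2.
suff H : ch x <= expR (2 * x ^+ 2) by rewrite /ch in H; lra.
have ch0 y : 0 <= ch y by rewrite divr_ge0 // addr_ge0 // expR_ge0.
have chD y : ch y <= ch (y / 2) ^+ 4.
  have e1 : expR y = expR (y / 2) ^+ 2 by rewrite -expRM_natr; congr expR; field.
  have e2 : expR (- y) = expR (- (y / 2)) ^+ 2 by rewrite -expRM_natr; congr expR; field.
  have e3 : expR (y / 2) * expR (- (y / 2)) = 1 by rewrite -expRD subrr expR0.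
  rewrite /ch e1 e2; set a := expR _ in e3 *; set b := expR _ in e3 *.
  have -> : (a ^+ 2 + b ^+ 2) / 2 = 2 * ((a + b) / 2) ^+ 2 - a * b by field.
  rewrite e3; have := sqr_ge0 (((a + b) / 2) ^+ 2 - 1); nra.
have small y : `|y| <= 1 / 2 -> ch y <= expR (2 * y ^+ 2).
  rewrite ler_norml => /andP[y1 y2].
  have ineq (z : R) : - (1 / 2) <= z <= 1 / 2 -> expR z <= (1 - z)^-1.
    move=> /andP[z1 z2]; rewrite -[z]opprK expRN lef_pV2 ?posrE ?expR_gt0 //; last lra.
    by have := expR_ge1Dx (- z); rewrite opprK.
  have h1 : expR y <= (1 - y)^-1 by apply: ineq; apply/andP; split; lra.
  have h2 : expR (- y) <= (1 + y)^-1.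
    by have := ineq (- y); rewrite opprK; apply; apply/andP; split; lra.
  apply: le_trans (expR_ge1Dx _); rewrite /ch.
  have -> : 1 + 2 * y ^+ 2 = (2 * (1 + 2 * y ^+ 2)) / 2 by field.
  rewrite ler_pM2r ?invr_gt0 // (le_trans (lerD h1 h2)) //.
  have -> : (1 - y)^-1 + (1 + y)^-1 = 2 / (1 - y ^+ 2).
    by field; rewrite !gt_eqF //; nra.
  have t0 := sqr_ge0 y; have t1 : y ^+ 2 <= 1 / 4 by nra.
  move: (y ^+ 2) t0 t1 => t t0 t1.
  rewrite ler_pdivrMr; nra.
have main n y : `|y| <= 2 ^+ n / 2 -> ch y <= expR (2 * y ^+ 2).
  elim: n y => [|n IH] y; first by rewrite expr0; exact: small.
  rewrite exprS => hy; apply: le_trans (chD y) _.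
  have : ch (y / 2) <= expR (2 * (y / 2) ^+ 2).
    by apply: IH; rewrite normrM normfV (ger0_norm (_ : 0 <= 2)) // ler_pdivrMr // mulrC; lra.
  move=> h; have : ch (y / 2) ^+ 4 <= expR (2 * (y / 2) ^+ 2) ^+ 4.
    by rewrite ler_pXn2r ?nnegrE ?ch0 ?expR_ge0.
  by rewrite -expRM_natr (_ : _ * 4%:R = 2 * y ^+ 2) //; field.
have [n hn] : exists n, `|x| <= 2 ^+ n / 2.
  exists (Num.bound (2 * `|x|)); rewrite ler_pdivlMr // mulrC ltW //.
  by apply: upper_nthrootP.
exact: main hn.
Qed.

(** Telescoping: [(1 + s(a-1)) (1 + sa) <= (1 + sa)^2 <= 2 (1 + s^2 a^2)] bounds the [a]-th term by
    [2/s] times the difference of [1 / (1 + s(a-1))] and [1 / (1 + sa)]. *)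
Lemma sum_inv_sqr_le (R : realType) (s : R) m : 0 < s ->
  \sum_(1 <= a < m.+1) (1 + s ^+ 2 * a%:R ^+ 2)^-1 <= 2 / s.
Proof.
move=> s0.
suff main : \sum_(1 <= a < m.+1) (1 + s ^+ 2 * a%:R ^+ 2)^-1 <= 2 / s * (1 - (1 + s * m%:R)^-1).
  apply: le_trans main _; rewrite -[leRHS]mulr1.
  apply: ler_wpM2l; first by rewrite divr_ge0 // ltW.
  rewrite gerDl oppr_le0 invr_ge0.
  by rewrite addr_ge0 // mulr_ge0 // ltW.
elim: m => [|m IH]; first by rewrite big_geq // mulr0 addr0 invr1 subrr mulr0.
rewrite big_nat_recr //=; apply: le_trans (lerD IH (lexx _)) _.
rewrite -lerBrDl -mulrBr.
set b : R := m%:R; have b0 : 0 <= b by rewrite ler0n.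
have -> : m.+1%:R = b + 1 :> R by rewrite -natr1.
have p1 : 0 < 1 + s * b by nra.
have p2 : 0 < 1 + s * (b + 1) by nra.
have p3 : 0 < 1 + s ^+ 2 * (b + 1) ^+ 2 by nra.
have -> : 2 / s * (1 - (1 + s * (b + 1))^-1 - (1 - (1 + s * b)^-1)) =
   2 / ((1 + s * b) * (1 + s * (b + 1))).
  field; rewrite !gt_eqF //.
rewrite -[leLHS]div1r ler_pdivrMr // mulrAC ler_pdivlMr ?mulr_gt0 //.
have := mulr_ge0 (ltW s0) (ltW p2); have := sqr_ge0 (1 - s * (b + 1)); nra.
Qed.

(** Chernoff's method for both tails: the moment generating function at [lam] is at most
    [exp (lam^2 tau / 2)], and [lam = 1 / (2 tau)] minimises [lam^2 tau / 2 - lam / 2]. *)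
Lemma hoeffding_count (R : realType) r (v : 'I_r -> R) (tau : R) : 0 < tau ->
  \sum_i v i ^+ 2 <= tau ->
  #|[set a : {ffun 'I_r -> bool} | 1 / 2 <= `|\sum_i ((a i)%:R - 1 / 2) * v i| ]|%:R
    <= 2 * expR (- (8 * tau)^-1) * (2 ^ r)%:R.
Proof.
move=> tau0 vtau; set A := [set _ | _]; pose lam : R := (2 * tau)^-1.
pose X (a : {ffun 'I_r -> bool}) := \sum_i ((a i)%:R - 1 / 2) * v i.
have mgf (c : R) : `|c| = 1 ->
    \sum_(a : {ffun 'I_r -> bool}) expR (c * lam * X a) <= (2 ^ r)%:R * expR (lam ^+ 2 * tau / 2).
  move=> c1; have c2 : c ^+ 2 = 1 by rewrite -real_normK ?num_real // c1 expr1n.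
  pose F i (b : bool) := expR (c * lam * ((b%:R - 1 / 2) * v i)).
  rewrite (eq_bigr (fun a : {ffun 'I_r -> bool} => \prod_i F i (a i))); last first.
    by move=> a _; rewrite /X mulr_sumr expR_sum.
  rewrite -bigA_distr_bigA /=.
  apply: (@le_trans _ _ (\prod_(i < r) (2 * expR (lam ^+ 2 * v i ^+ 2 / 2)))).
    apply: ler_prod => i _; rewrite big_bool /F addr_ge0 ?expR_ge0 //=.
    have := cosh_le_exp_sqr (c * lam * v i / 2).
    have -> : 2 * (c * lam * v i / 2) ^+ 2 = lam ^+ 2 * v i ^+ 2 / 2 * c ^+ 2 by field.
    by rewrite c2 mulr1; congr (_ + _ <= _); congr expR; field.
  rewrite big_split /= prodr_const card_ord natrX ler_wpM2l ?exprn_ge0 //.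
  rewrite -expR_sum ler_expR -mulr_suml -mulr_sumr ler_pM2r ?invr_gt0 //.
  by rewrite ler_wpM2l ?sqr_ge0.
have key (a : {ffun 'I_r -> bool}) : a \in A ->
    1 <= expR (- (lam / 2)) * (expR (1 * lam * X a) + expR (-1 * lam * X a)).
  rewrite inE -/(X a) => hX.
  have lam0 : 0 < lam by rewrite invr_gt0 mulr_gt0.
  rewrite mulrDr -!expRD.
  have [x0|x0] := leP 0 (X a).
    rewrite ger0_norm // in hX.
    apply: (@le_trans _ _ (expR (- (lam / 2) + 1 * lam * X a))); last by rewrite lerDl expR_ge0.
    by rewrite -[leLHS]expR0 ler_expR; nra.
  rewrite ltr0_norm // in hX.
  apply: (@le_trans _ _ (expR (- (lam / 2) + -1 * lam * X a))); last by rewrite lerDr expR_ge0.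
  by rewrite -[leLHS]expR0 ler_expR; nra.
have -> : #|A|%:R = \sum_(a in A) (1 : R) by rewrite sumr_const.
apply: (@le_trans _ _ (\sum_(a in A)
   expR (- (lam / 2)) * (expR (1 * lam * X a) + expR (-1 * lam * X a)))).
  exact: ler_sum.
apply: (@le_trans _ _ (\sum_(a : {ffun 'I_r -> bool})
   expR (- (lam / 2)) * (expR (1 * lam * X a) + expR (-1 * lam * X a)))).
  rewrite [leRHS](bigID (mem A)) /= lerDl sumr_ge0 //.
rewrite -mulr_sumr big_split /=.
have := lerD (mgf 1 (normr1 _)) (mgf (-1) _); rewrite normrN1 => /(_ erefl) h.
apply: (le_trans (ler_wpM2l (expR_ge0 _) h)).
have eE : expR (- (lam / 2)) * expR (lam ^+ 2 * tau / 2) = expR (- (8 * tau)^-1).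
  by rewrite -expRD; congr expR; rewrite /lam; field; rewrite gt_eqF.
by rewrite -eE le_eqVlt; apply/orP; left; apply/eqP; ring.
Qed.

(** * Functionals are large on every window *)

Lemma coef_sum_ord (A : nzRingType) r (c : 'I_r -> A) (i : 'I_r) :
  (\sum_(k < r) c k *: 'X^k)`_i = c i.
Proof.
rewrite coef_sum (bigD1 i) //= coefZ coefXn eqxx mulr1 big1 ?addr0 // => k ki.
by rewrite coefZ coefXn eq_sym (inj_eq val_inj) (negPf ki) mulr0.
Qed.

Lemma size_sum_ord (A : nzRingType) r (c : 'I_r -> A) :
  (size (\sum_(k < r) c k *: 'X^k)%R <= r)%N.
Proof.
apply: (leq_trans (size_sum _ _ _)); apply/bigmax_leqP => k _.
by apply: (leq_trans (size_scale_leq _ _)); rewrite size_polyXn.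
Qed.

(** [P] is the difference of two bit vectors that agree modulo [D] and whose centred sums are below
    [1/2] on each of the [w] subwindows. Its pairing with a shift of the lift is divisible by [p],
    as [psi] kills multiples of [D], and smaller than [p] in absolute value; so it is [0] over the
    integers. *)
Lemma exists_small_relation (R : realType) p (psi : {linear {poly 'F_p} -> ('F_p)^o})
    (D : {poly 'F_p}) r w j0 (tau : R) :
  let y i := centered_lift (psi 'X^i) in
  prime p -> D != 0 -> (forall g, psi (g * D) = 0) ->
  0 < tau -> (2 * p ^ (size D).-1 < 2 ^ r)%N ->
  4 * w%:R * expR (- (8 * tau)^-1) <= 1 ->
  \sum_(j0 <= i < j0 + (w + r)) ((y i)%:~R / p%:R) ^+ 2 <= tau ->
  exists P : {poly int}, [/\ P != 0, forall i, `|P`_i| <= 1, (size P <= r)%N &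
    forall j, (j0 <= j < j0 + w)%N -> seq_pairing y ('X^j * P) = 0].
Proof.
move=> y p_pr nzD annD tau0 pr wtau ytau.
pose v j : R := (y j)%:~R / p%:R.
pose S j (a : {ffun 'I_r -> bool}) : R := \sum_i ((a i)%:R - 1 / 2) * v (j0 + j + i)%N.
pose bad j := [set a : {ffun 'I_r -> bool} | 1 / 2 <= `|S j a|].
have v2 j : (j < w)%N -> \sum_(i < r) v (j0 + j + i)%N ^+ 2 <= tau.
  move=> ltj; apply: le_trans ytau.
  rewrite -(big_mkord xpredT (fun i => v (j0 + j + i)%N ^+ 2)).
  have l1 : (j0 <= j0 + j)%N by lia.
  have l2 : (j0 + j <= j0 + j + r)%N by lia.
  have l3 : (j0 + j + r <= j0 + (w + r))%N by lia.
  rewrite (big_cat_nat l1 (leq_trans l2 l3)) /=.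
  rewrite [X in _ <= _ + X](big_cat_nat l2 l3) /=.
  have -> : \sum_(j0 + j <= i < j0 + j + r) v i ^+ 2 = \sum_(0 <= i < r) v (j0 + j + i)%N ^+ 2.
    rewrite -{1}[(j0 + j)%N]add0n big_addn addKn.
    by apply: eq_bigr => i _; rewrite addnC.
  rewrite addrCA lerDl addr_ge0 // sumr_ge0 // => i _; exact: sqr_ge0.
have badle j : (j < w)%N -> #|bad j|%:R <= 2 * expR (- (8 * tau)^-1) * (2 ^ r)%:R :> R.
  by move=> ltj; apply: hoeffding_count => //; exact: v2.
pose good := [set a : {ffun 'I_r -> bool} | [forall j : 'I_w, a \notin bad j]].
(* By [wtau], the [w] subwindows together exclude at most half of the bit vectors. *)
have goodge : (2 ^ r)%:R / 2 <= #|good|%:R :> R.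
  have : (2 ^ r <= #|good| + \sum_(j < w) #|bad j|)%N.
    have -> : (2 ^ r = #|{: {ffun 'I_r -> bool}}|)%N by rewrite card_ffun card_bool card_ord.
    rewrite -(cardsC good) leq_add2l -sum1_card.
    apply: (@leq_trans (\sum_(a in ~: good) \sum_(j < w) (a \in bad j))).
      apply: leq_sum => a; rewrite !inE negb_forall => /existsP[j]; rewrite negbK => aj.
      by rewrite (bigD1 j) //= aj.
    rewrite exchange_big /=; apply: leq_sum => j _.
    rewrite -sum1_card [leqRHS]big_mkcond /= [leqLHS]big_mkcond /=.
    by apply: leq_sum => a _; case: (a \in bad j); case: ifP.
  rewrite -(ler_nat R) natrD natr_sum => h.
  have : \sum_(j < w) #|bad j|%:R <= w%:R * (2 * expR (- (8 * tau)^-1) * (2 ^ r)%:R) :> R.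
    rewrite mulr_natl -[w in _ *+ w]card_ord -sumr_const; apply: ler_sum => j _.
    exact: badle.
  move: wtau; set e := expR _ => wtau h2.
  have N0 : 0 <= (2 ^ r)%:R :> R by rewrite ler0n.
  move: (2 ^ r)%:R N0 h h2 => M M0 h h2.
  have : 2 * w%:R * e * M <= M / 2 by have := ler_wpM2r M0 wtau; lra.
  lra.
have {}goodge : (p ^ (size D).-1 < #|good|)%N.
  rewrite -(ltr_nat R); apply: lt_le_trans goodge.
  by rewrite ltr_pdivlMr // mulrC -natrM ltr_nat.
pose A (a : {ffun 'I_r -> bool}) : {poly 'F_p} := \sum_(i < r) (a i)%:R *: 'X^i.
(* The pigeonholes: remainders modulo [D], in a finite type with [p^(deg D)] elements. *)
pose h a := npolyp (size D).-1 (A a %% D).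
have hK a : h a = A a %% D :> {poly 'F_p}.
  by rewrite npolypK // -ltnS prednK ?size_poly_gt0 // ltn_modp.
have [a [a' [ga ga' naa' eh]]] : exists a a', [/\ a \in good, a' \in good, a != a' & h a = h a'].
  apply: contrapT => hN; have : {in good &, injective h}.
    move=> a a' ga ga' e; apply/eqP; apply: contrapT => /negP ne; apply: hN.
    by exists a, a'.
  move/card_in_imset => e; have := max_card (h @: good).
  rewrite e card_npoly card_Fp //; lia.
pose c (i : 'I_r) : int := (a i)%:Z - (a' i)%:Z.
pose P : {poly int} := \sum_(i < r) c i *: 'X^i.
have c1 i : `|c i| <= 1 by rewrite /c; case: (a i); case: (a' i).
exists P; split.
- apply: contraNneq naa' => P0; apply/eqP/ffunP => i.
  have := coef_sum_ord c i; rewrite -/P P0 coef0 /c.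
  by case: (a i); case: (a' i).
- move=> i; have [lti|gei] := ltnP i r; last by rewrite nth_default ?normr0 // (leq_trans (size_sum_ord c)).
  by rewrite (coef_sum_ord c (Ordinal lti)).
- exact: size_sum_ord.
move=> j hj; have [k [jE ltk]] : exists k, j = (j0 + k)%N /\ (k < w)%N.
  by exists (j - j0)%N; lia.
set z := seq_pairing _ _.
have zE : z = \sum_(i < r) c i * y (j + i)%N.
  rewrite /z /P mulr_sumr raddf_sum; apply: eq_bigr => i _.
  by rewrite -scalerAr /= seq_pairingZ -exprD seq_pairingXn.
have : (p%:Z %| z)%Z.
  rewrite (dvdz_pcharf (pchar_Fp p_pr)) (seq_pairing_modp (psi := psi)); last first.
    by move=> i; exact: centered_liftK.
  have -> : map_poly intr ('X^j * P) = ('X^j * (A a %/ D - A a' %/ D)) * D.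
    rewrite rmorphM rmorphXn /= map_polyX -mulrA; congr (_ * _).
    have := divp_eq (A a) D; have := divp_eq (A a') D.
    rewrite -(hK a) -(hK a') eh => e1 e2.
    have -> : (A a %/ D - A a' %/ D) * D = A a - A a'.
      by rewrite {2}e2 {2}e1 mulrBl; ring.
    rewrite /P /A rmorph_sum -sumrB /=; apply: eq_bigr => i _.
    rewrite map_polyZ /= map_polyXn -scalerBl /c rmorphB /=.
    by case: (a i); case: (a' i).
  by rewrite annD.
have zp : `|z%:~R / p%:R| < 1 :> R.
  have -> : z%:~R / p%:R = S k a - S k a'.
    rewrite zE rmorph_sum mulr_suml /S -sumrB; apply: eq_bigr => i _.
    rewrite /v jE -mulrBl opprB addrA subrK rmorphM /= -mulrA; congr (_ * _).
    by rewrite /c rmorphB.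
  have gS b : b \in good -> `|S k b| < 1 / 2.
    by rewrite inE => /forallP /(_ (Ordinal ltk)); rewrite inE -ltNge.
  apply: le_lt_trans (ler_normB _ _) _.
  by rewrite [1](splitr 1) ltrD // gS.
move: zp; rewrite normrM normfV (ger0_norm (ler0n _ p)) ltr_pdivrMr ?ltr0n ?prime_gt0 //.
rewrite mul1r -intr_norm -[p%:R]/((p%:Z)%:~R) ltr_int.
move=> zp /dvdzP[u zu]; apply/eqP; rewrite zu mulf_eq0.
have p_gt0 := prime_gt0 p_pr.
move: zp; rewrite zu normrM => zp.
have u1 : `|u| < 1 by nia.
by have -> : u = 0 by lia.
Qed.

Lemma window_sum_gt (R : realType) p (psi : {linear {poly 'F_p} -> ('F_p)^o})
    (D : {poly 'F_p}) (s : seq nat) r Q l j0 w (tau : R) :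
  prime p -> (p <= 2 ^ l)%N -> D != 0 -> (forall g, psi (g * D) = 0) ->
  (exists g, psi g != 0) ->
  (forall phi, irreducible_poly phi -> phi %| D -> ~~ (phi %| 'X) /\
     forall t, (0 < t <= Q)%N -> ~~ (phi %| 'X^t - 1)) ->
  uniq s -> size s = r -> (forall q, q \in s -> [/\ prime q, 2 * r <= q & q <= Q])%N ->
  (size D + l * (Q * r) <= w)%N ->
  0 < tau -> (2 * p ^ (size D).-1 < 2 ^ r)%N ->
  4 * w%:R * expR (- (8 * tau)^-1) <= 1 ->
  tau < \sum_(j0 <= i < j0 + (w + r)) ((centered_lift (psi 'X^i))%:~R / p%:R) ^+ 2.
Proof.
move=> p_pr pl nzD annD psiN good us szs sP lew tau0 pr wtau.
rewrite ltNge; apply/negP => le_tau.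
have [P [nzP P1 szP yP]] := exists_small_relation p_pr nzD annD tau0 pr wtau le_tau.
have [phi [irr phiD]] :=
  window_relation_divisor p_pr pl nzD annD psiN nzP P1 szP us szs sP lew yP.
have [nX nt] := good phi irr phiD.
by case=> [|[t [ht]]]; [rewrite (negPf nX) | rewrite (negPf (nt t ht))].
Qed.

Lemma sum_ge_windows (R : realType) (f : nat -> R) n W (tau : R) :
  (forall i, 0 <= f i) -> (forall j, tau <= \sum_(j <= i < j + W) f i) ->
  ((n %/ W)%:R * tau <= \sum_(i < n) f i).
Proof.
move=> f0 ftau.
have main B : B%:R * tau <= \sum_(0 <= i < B * W) f i.
  elim: B => [|B IH]; first by rewrite mul0r mul0n big_geq.
  rewrite (@big_cat_nat _ _ _ (B * W)) //=; last by rewrite leq_mul2r leqnSn orbT.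
  by rewrite -natr1 mulrDl mul1r lerD // mulSn addnC.
rewrite -(big_mkord xpredT) (@big_cat_nat _ _ _ (n %/ W * W)) //= ?leq_divM //.
by rewrite (le_trans (main _)) // lerDl sumr_ge0.
Qed.

(** * Characters of the prime field *)

Section CosF.
Variables (R : realType) (p : nat).
Hypothesis p_pr : prime p.

Definition angle (k : nat) : R := 2 * pi * (k%:R / p%:R).
Definition cosF (x : 'F_p) : R := cos (angle x).
Definition sinF (x : 'F_p) : R := sin (angle x).

Lemma pR_neq0 : (p%:R : R) != 0.
Proof. by rewrite pnatr_eq0 -lt0n prime_gt0. Qed.

Lemma angleD a b : angle (a + b) = angle a + angle b.
Proof. by rewrite /angle natrD -mulrDr -mulrDl. Qed.

Lemma angle_mod k : cos (angle (k %% p)) = cos (angle k) /\ sin (angle (k %% p)) = sin (angle k).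
Proof.
have E (m : nat) : angle (m * p) = (pi *+ 2) *+ m.
  rewrite /angle natrM mulfK ?pR_neq0 //.
    by rewrite -[RHS]mulr_natr -[pi *+ 2]mulr_natl.
have -> : angle k = angle (k %% p) + (pi *+ 2) *+ (k %/ p).
  by rewrite {1}(divn_eq k p) addnC angleD E.
by rewrite (periodicn (@cosD2pi R)) (periodicn (@sinD2pi R)).
Qed.

Lemma val_FpD (x y : 'F_p) : (x + y)%R = ((x + y) %% p)%N :> nat.
Proof. by rewrite /= [X in (_ %% X)%N]Fp_cast. Qed.

Lemma cosF_D x y : cosF (x + y) = cosF x * cosF y - sinF x * sinF y.
Proof.
rewrite /cosF val_FpD.
by have [-> _] := angle_mod (x + y); rewrite angleD cosD.
Qed.

Lemma sinF_D x y : sinF (x + y) = sinF x * cosF y + cosF x * sinF y.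
Proof.
rewrite /sinF val_FpD.
by have [_ ->] := angle_mod (x + y); rewrite angleD sinD.
Qed.

Lemma cosF0 : cosF 0 = 1.
Proof. by rewrite /cosF /angle mul0r mulr0 cos0. Qed.

Lemma sinF0 : sinF 0 = 0.
Proof. by rewrite /sinF /angle mul0r mulr0 sin0. Qed.

Lemma cosF_sinF x : cosF x ^+ 2 + sinF x ^+ 2 = 1.
Proof. exact: cos2Dsin2. Qed.

(** Solving the addition formulas at [x + (- x) = 0] avoids the representative of [- x]. *)
Lemma cosFN x : cosF (- x) = cosF x /\ sinF (- x) = - sinF x.
Proof.
have := cosF_D x (- x); have := sinF_D x (- x); rewrite subrr cosF0 sinF0.
have := cosF_sinF x.
move: (cosF x) (sinF x) (cosF (- x)) (sinF (- x)) => a b c d e1 e2 e3.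
have h1 : c = a * (a * c - b * d) + b * (b * c + a * d) by rewrite -[LHS]mul1r -e1; ring.
have h2 : d = a * (b * c + a * d) - b * (a * c - b * d) by rewrite -[LHS]mul1r -e1; ring.
by split; [rewrite h1 -e2 -e3; ring | rewrite h2 -e2 -e3; ring].
Qed.

Lemma cosF_B x y : cosF (x - y) = cosF x * cosF y + sinF x * sinF y.
Proof. by have [e1 e2] := cosFN y; rewrite cosF_D e1 e2 mulrN opprK. Qed.

(** The versine, which equals [|1 - exp (2 pi i x / p)|^2 / 2]. *)
Definition vers (x : 'F_p) : R := 1 - cosF x.

Lemma vers_ge0 x : 0 <= vers x.
Proof. by rewrite subr_ge0 cos_le1. Qed.

Lemma vers_ge_lift (x : 'F_p) : 2 * ((centered_lift x)%:~R / p%:R) ^+ 2 <= vers x.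
Proof.
have -> : vers x = 1 - cos (2 * pi * ((centered_lift x)%:~R / p%:R)).
  rewrite /vers /cosF /angle /centered_lift; case: ifP => _ //; congr (1 - _).
  rewrite rmorphB /= mulrBl divff ?pR_neq0 // -[RHS]cosD2pi; congr cos; ring.
apply: one_sub_cos_ge.
have p0 : 0 < p%:R :> R by rewrite ltr0n prime_gt0.
rewrite normrM normfV (ger0_norm (ler0n _ p)) ler_pdivrMr //.
suff : 2 * `|(centered_lift x)%:~R| <= p%:R :> R by lra.
rewrite -intr_norm -[p%:R]/((p%:Z)%:~R) -[2]/((2%:Z)%:~R) -rmorphM /= ler_int.
by have := centered_lift_bound x p_pr.
Qed.

(** The additive character [exp (2 pi i x / p)]. *)
Definition expF (x : 'F_p) : R[i] := Complex (cosF x) (sinF x).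

Lemma expF_D x y : expF (x + y) = expF x * expF y.
Proof. by apply/eqP; rewrite eq_complex /= cosF_D sinF_D [X in _ && (_ == X)]addrC !eqxx. Qed.

Lemma expF0 : expF 0 = 1.
Proof. by apply/eqP; rewrite eq_complex /= cosF0 sinF0 !eqxx. Qed.

Lemma expF_sum (I : Type) (s : seq I) (F : I -> 'F_p) :
  expF (\sum_(i <- s) F i) = \prod_(i <- s) expF (F i).
Proof. by apply: big_morph; [exact: expF_D | exact: expF0]. Qed.

Lemma expF_neq1 x : x != 0 -> expF x != 1.
Proof.
move=> nx; apply/eqP => e.
have c1 : cosF x = 1 by have := congr1 (@complex.Re R) e.
have := vers_ge_lift x; rewrite /vers c1 subrr.
have := sqr_ge0 ((centered_lift x)%:~R / p%:R : R).
move=> h1 h2; have : (centered_lift x)%:~R / p%:R == 0 :> R.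
  by rewrite -sqrf_eq0; apply/eqP; lra.
rewrite mulf_eq0 invr_eq0 (negPf pR_neq0) orbF intr_eq0 => /eqP e0.
by move: nx; rewrite -(centered_liftK x p_pr) e0 eqxx.
Qed.

Lemma sum_expF y : \sum_x expF (x * y) = (if y == 0 then p%:R else 0) :> R[i].
Proof.
case: eqP => [->|/eqP ny].
  rewrite (eq_bigr (fun=> 1)) => [|x _]; last by rewrite mulr0 expF0.
  by rewrite sumr_const card_Fp.
set S := \sum_x _.
have : expF y * S = S.
  rewrite /S mulr_sumr [RHS](reindex_inj (addIr 1)) /=; apply: eq_bigr => x _.
  by rewrite mulrDl mul1r expF_D mulrC.
move/eqP; rewrite -subr_eq0 -{2}[S]mul1r -mulrBl mulf_eq0 subr_eq0.
by rewrite (negPf (expF_neq1 ny)) => /eqP.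
Qed.

Definition charfun (m : 'F_p -> R) (u : 'F_p) : R[i] :=
  \sum_x (m x)%:C%C * expF (x * u).

Lemma charfun0 m : \sum_x m x = 1 -> charfun m 0 = 1.
Proof.
move=> m1; rewrite /charfun (eq_bigr (fun x => (m x)%:C%C)); last first.
  by move=> x _; rewrite mulr0 expF0 mulr1.
by rewrite -rmorph_sum m1.
Qed.

Lemma normc_sqr (z : R[i]) : normc z ^+ 2 = complex.Re z ^+ 2 + complex.Im z ^+ 2.
Proof. by case: z => a b /=; rewrite sqr_sqrtr // addr_ge0 ?sqr_ge0. Qed.

Lemma normc_ge0 (z : R[i]) : 0 <= normc z.
Proof. by case: z => a b /=; exact: sqrtr_ge0. Qed.

(** Symmetrisation: the squared modulus is the mean of [cosF (u * (x - y))] over independent [x],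
    [y], that is [1 - t] with [t] the double sum; then [1 - t <= exp (- t)]. *)
Lemma charfun_le m u : (forall x, 0 <= m x) -> \sum_x m x = 1 ->
  normc (charfun m u) <= expR (- (\sum_x \sum_y m x * m y * vers (u * (x - y))) / 2).
Proof.
move=> m0 m1.
have e : normc (charfun m u) ^+ 2 = 1 - \sum_x \sum_y m x * m y * vers (u * (x - y)).
  have ReE : complex.Re (charfun m u) = \sum_x m x * cosF (x * u).
    rewrite /charfun (big_morph (@complex.Re R) (id1 := 0) (op1 := +%R)) //; last by case=> ? ? [].
    by apply: eq_bigr => x _ /=; rewrite mul0r subr0.
  have ImE : complex.Im (charfun m u) = \sum_x m x * sinF (x * u).
    rewrite /charfun (big_morph (@complex.Im R) (id1 := 0) (op1 := +%R)) //; last by case=> ? ? [].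
    by apply: eq_bigr => x _ /=; rewrite mul0r addr0.
  rewrite normc_sqr ReE ImE !expr2 !mulr_suml -big_split /=.
  have {1}-> : 1 = \sum_x \sum_y m x * m y.
    by rewrite -[1]mulr1 -{1}m1 mulr_suml; apply: eq_bigr => x _; rewrite -m1 mulr_sumr.
  rewrite -sumrB; apply: eq_bigr => x _.
  rewrite !mulr_sumr -sumrB -big_split /=; apply: eq_bigr => y _.
  rewrite [u * (x - y)]mulrBr /vers [u * x]mulrC [u * y]mulrC cosF_B; ring.
rewrite -(ler_pXn2r (n := 2)) ?nnegrE ?normc_ge0 ?expR_ge0 // e -expRM_natr.
rewrite mulfVK // ?pnatr_eq0 //; exact: expR_ge1Dx.
Qed.

End CosF.

(** * Fourier expansion of the probability of a divisor *)

(** The linear functionals on [F[X]/(D)], parametrised by their values [b j] on the powers ['X^j],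
    [j < deg D], and pulled back to [F[X]]. *)
Definition modp_functional (F : fieldType) (D : {poly F})
    (b : {ffun 'I_(size D).-1 -> F}) (g : {poly F}) : F :=
  \sum_j b j * (g %% D)`_j.

Lemma modp_functional_linear (F : fieldType) (D : {poly F}) b :
  linear (modp_functional (D := D) b : {poly F} -> F^o).
Proof.
move=> a f g; rewrite /modp_functional.
rewrite -[a *: \sum_j _]/(a * _) mulr_sumr -big_split /=; apply: eq_bigr => j _.
by rewrite modpD modpZl coefD coefZ mulrDr mulrCA.
Qed.

HB.instance Definition _ (F : fieldType) (D : {poly F}) b :=
  GRing.isLinear.Build F {poly F} F^o _ (modp_functional (D := D) b)
    (modp_functional_linear b).

Lemma modp_functional_mul (F : fieldType) (D : {poly F}) b g :
  modp_functional (D := D) b (g * D) = 0.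
Proof. by rewrite /modp_functional modp_mull big1 // => j _; rewrite coef0 mulr0. Qed.

Lemma modp_functionalX (F : fieldType) (D : {poly F}) b (j : 'I_(size D).-1) :
  modp_functional (D := D) b 'X^j = b j.
Proof.
rewrite /modp_functional modp_small; last first.
  rewrite size_polyXn; move: (nat_of_ord j) (ltn_ord j) => k.
  by case: (size D).
rewrite (bigD1 j) //= coefXn eqxx mulr1 big1 ?addr0 // => i ij.
by rewrite coefXn (inj_eq val_inj) (negPf ij) mulr0.
Qed.

Lemma modp_functionalZ (F : fieldType) (D : {poly F}) b a (g : {poly F}) :
  modp_functional (D := D) b (a *: g) = a * modp_functional b g.
Proof. by have := modp_functional_linear b a g 0; rewrite !addr0 raddf0 addr0. Qed.

Section Fourier.
Variables (R : realType) (p : nat).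
Hypothesis p_pr : prime p.
Local Notation expF := (@expF R p).
Local Notation F := 'F_p.

Lemma sum_expF_modp (D g : {poly F}) : D != 0 ->
  \sum_(b : {ffun 'I_(size D).-1 -> F}) expF (modp_functional b g) =
  (p ^ (size D).-1)%:R * (D %| g)%R%:R.
Proof.
move=> nzD; set e := (size D).-1.
rewrite (eq_bigr (fun b : {ffun 'I_e -> F} => \prod_j expF (b j * (g %% D)`_j))); last first.
  by move=> b _; rewrite (expF_sum _ p_pr).
rewrite -(bigA_distr_bigA (fun (j : 'I_e) (x : F) => expF (x * (g %% D)`_j))) /=.
rewrite (eq_bigr (fun j : 'I_e => if (g %% D)`_j == 0 then p%:R else 0)); last first.
  by move=> j _; rewrite sum_expF.
have [Dg|nDg] := boolP (D %| g).
  rewrite (eq_bigr (fun=> p%:R)) ?prodr_const ?card_ord ?mulr1 ?natrX // => j _.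
  by move/eqP: Dg => ->; rewrite coef0 eqxx.
rewrite mulr0; have [j nj] : exists j : 'I_e, (g %% D)`_j != 0.
  have lte : ((size (g %% D)%R).-1 < e)%N.
    have := ltn_modp g D; rewrite nzD /e; have : (0 < size (g %% D)%R)%N by rewrite size_poly_gt0.
    by case: (size (g %% D)%R) => // x; case: (size D).
  exists (Ordinal lte) => /=; rewrite -lead_coefE lead_coef_eq0; exact: nDg.
by rewrite (bigD1 j) //= (negPf nj) mul0r.
Qed.

Variable n : nat.
Implicit Types m : 'I_n.+1 -> F -> R.

(** The coefficient law may depend on the index, which covers both [f] and the monic polynomial with
    its constant top coefficient. *)
Definition weight m (c : {ffun 'I_n.+1 -> F}) : R := \prod_i m i (c i).
Definition coef_poly (c : {ffun 'I_n.+1 -> F}) : {poly F} := \sum_(i < n.+1) c i *: 'X^i.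
Definition wprob m (B : pred {poly F}) : R := \sum_c weight m c * (B (coef_poly c))%:R.

Lemma sum_weight m : (forall i, \sum_x m i x = 1) -> \sum_c weight m c = 1.
Proof.
by move=> m1; rewrite /weight -(bigA_distr_bigA m) /= big1.
Qed.

Lemma weight_ge0 m c : (forall i x, 0 <= m i x) -> 0 <= weight m c.
Proof. by move=> m0; exact: prodr_ge0. Qed.

Lemma sum_weight_expF m (psi : {linear {poly F} -> F^o}) t :
  \sum_c (weight m c)%:C%C * expF (t * psi (coef_poly c)) =
  \prod_i charfun (m i) (t * psi 'X^i).
Proof.
rewrite (bigA_distr_bigA (fun i x => (m i x)%:C%C * expF (x * (t * psi 'X^i)))).
apply: eq_bigr => c _; rewrite big_split /= -rmorph_prod -(expF_sum _ p_pr).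
congr (_ * expF _); rewrite raddf_sum mulr_sumr; apply: eq_bigr => i _.
by rewrite /= linearZ /= mulrCA.
Qed.

Lemma wprob_dvdp m (D : {poly F}) : D != 0 ->
  (((p ^ (size D).-1)%:R * wprob m (fun g => D %| g))%:C)%C =
  \sum_(b : {ffun 'I_(size D).-1 -> F}) \prod_i charfun (m i) (modp_functional b 'X^i).
Proof.
move=> nzD; transitivity (\sum_c (weight m c)%:C%C *
  \sum_(b : {ffun 'I_(size D).-1 -> F}) expF (modp_functional b (coef_poly c))).
  rewrite /wprob mulr_sumr rmorph_sum /=; apply: eq_bigr => c _.
  rewrite sum_expF_modp // mulrCA rmorphM /=; congr (_ * _).
  by rewrite -!natrM rmorph_nat.
under eq_bigr do rewrite mulr_sumr.
rewrite exchange_big /=; apply: eq_bigr => b _.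
transitivity (\sum_c (weight m c)%:C%C * expF (1 * modp_functional b (coef_poly c))).
  by apply: eq_bigr => c _; rewrite mul1r.
rewrite (sum_weight_expF m (modp_functional b)); apply: eq_bigr => i _.
by rewrite mul1r.
Qed.

Lemma normc_real (x : R) : normc (x%:C)%C = `|x|.
Proof. by rewrite /= expr0n addr0 sqrtr_sqr. Qed.

Lemma normc_prod (I : Type) (s : seq I) (f : I -> R[i]) :
  normc (\prod_(i <- s) f i) = \prod_(i <- s) normc (f i).
Proof. apply: (big_morph _ (@normcM R)); exact: normc1. Qed.

Lemma normc_sum (I : Type) (s : seq I) (P : pred I) (f : I -> R[i]) :
  normc (\sum_(i <- s | P i) f i) <= \sum_(i <- s | P i) normc (f i).
Proof.
elim/big_rec2: _ => [|i x y _ h]; first by rewrite normc0.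
by apply: (le_trans (le_normcD _ _)); rewrite lerD2l.
Qed.

Lemma wprob_dvdp_dist m (D : {poly F}) : D != 0 -> (forall i, \sum_x m i x = 1) ->
  `|(p ^ (size D).-1)%:R * wprob m (fun g => D %| g) - 1| <=
  \sum_(b : {ffun 'I_(size D).-1 -> F} | b != 0)
     \prod_i normc (charfun (m i) (modp_functional b 'X^i)).
Proof.
move=> nzD m1; rewrite -normc_real.
set A := _ * wprob _ _.
have -> : (A - 1)%:C%C = A%:C%C - 1 by rewrite rmorphB rmorph1.
rewrite /A wprob_dvdp //.
(* The zero functional supplies the main term [1]. *)
rewrite (bigD1 (0 : {ffun _ -> F})) //= big1 => [|i _]; last first.
  rewrite (_ : modp_functional _ _ = 0) ?charfun0 //.
  by rewrite /modp_functional big1 // => j _; rewrite ffunE mul0r.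
rewrite [1 + _]addrC addrK; apply: (le_trans (normc_sum _ _ _)).
by apply: ler_sum => b _; rewrite normc_prod.
Qed.

Lemma modp_functional_neq0 (D : {poly F}) (b : {ffun 'I_(size D).-1 -> F}) : b != 0 ->
  exists2 j : 'I_(size D).-1, b j != 0 & modp_functional b 'X^j = b j.
Proof.
move=> nb; have [j nj] : exists j, b j != 0.
  apply: contrapT => h; move: nb; rewrite (_ : b = 0) ?eqxx //; apply/ffunP => j.
  by rewrite ffunE; apply: contrapT => /eqP hj; apply: h; exists j.
by exists j => //; rewrite modp_functionalX.
Qed.

End Fourier.

(** * Equidistribution modulo a good divisor *)

Section Equidistribution.
Variables (R : realType) (p : nat).
Hypothesis p_pr : prime p.
Variable n : nat.
Local Notation F := 'F_p.

Lemma prod_charfun_le (mu : F -> R) (u : 'I_n.+1 -> F) :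
  (forall x, 0 <= mu x) -> \sum_x mu x = 1 ->
  \prod_i normc (charfun mu (u i)) <=
  expR (- (\sum_x \sum_y mu x * mu y * \sum_i vers R (u i * (x - y))) / 2).
Proof.
move=> mu0 mu1.
apply: (@le_trans _ _ (\prod_i expR (- (\sum_x \sum_y mu x * mu y * vers R (u i * (x - y))) / 2))).
  by apply: ler_prod => i _; rewrite normc_ge0 charfun_le.
rewrite -expR_sum ler_expR -mulr_suml sumrN le_eqVlt; apply/orP; left; apply/eqP.
congr (- _ / _); rewrite exchange_big /=; apply: eq_bigr => x _.
by rewrite exchange_big /=; apply: eq_bigr => y _; rewrite mulr_sumr.
Qed.

(** Here [eta] bounds from below the probability that two independent coefficients differ. Each pair
    [x != y] contributes at least [2 L] to the exponent, by [vers_ge_lift], before the factor [1/2]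
    of [charfun_le]. *)
Lemma wprob_good_dist (mu : F -> R) (eta L : R) (D : {poly F}) :
  (forall x, 0 <= mu x) -> \sum_x mu x = 1 -> 0 <= L ->
  eta <= \sum_x \sum_(y | y != x) mu x * mu y -> D != 0 ->
  (forall b : {ffun 'I_(size D).-1 -> F}, b != 0 ->
     L <= \sum_(i < n.+1) ((centered_lift (modp_functional b 'X^i))%:~R / p%:R) ^+ 2) ->
  `|(p ^ (size D).-1)%:R * wprob (n := n) (fun=> mu) (fun g => D %| g) - 1| <=
    (p ^ (size D).-1)%:R * expR (- (eta * L)).
Proof.
move=> mu0 mu1 L0 eta_le nzD bL; apply: (le_trans (wprob_dvdp_dist p_pr nzD (fun=> mu1))).
apply: (@le_trans _ _ (\sum_(b : {ffun 'I_(size D).-1 -> F} | b != 0) expR (- (eta * L)))).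
  apply: ler_sum => b nb.
  apply: (le_trans (prod_charfun_le (fun i : 'I_n.+1 => modp_functional b 'X^i) mu0 mu1)).
  rewrite ler_expR mulNr lerN2 ler_pdivlMr // mulrC.
  apply: (@le_trans _ _ (\sum_x \sum_(y | y != x) mu x * mu y * (2 * L))).
    apply: (@le_trans _ _ ((\sum_x \sum_(y | y != x) mu x * mu y) * (2 * L))).
      by rewrite mulrCA ler_wpM2r // mulr_ge0.
    by rewrite mulr_suml ler_sum // => x _; rewrite mulr_suml.
  apply: ler_sum => x _; rewrite [leRHS](bigD1 x) //=.
  rewrite (_ : \sum_i vers R (_ * (x - x)) = 0); last first.
    by rewrite big1 // => i _; rewrite subrr mulr0 /vers cosF0 subrr.
  rewrite mulr0 add0r.
  apply: ler_sum => y nyx; rewrite ler_wpM2l ?mulr_ge0 //.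
  (* Scaling by [x - y] gives another nonzero functional, to which [bL] applies. *)
  pose b' := [ffun j => (x - y) * b j].
  have nb' : b' != 0.
    apply: contraNneq nb => b'0; apply/eqP/ffunP => j.
    have := congr1 (fun f : {ffun _} => f j) b'0; rewrite !ffunE => /eqP.
    by rewrite mulf_eq0 subr_eq0 eq_sym (negPf nyx) => /eqP.
  apply: le_trans (_ : 2 * (\sum_(i < n.+1) ((centered_lift (modp_functional b' 'X^i))%:~R / p%:R) ^+ 2) <= _).
    by rewrite ler_wpM2l // bL.
  rewrite mulr_sumr; apply: ler_sum => i _.
  have -> : modp_functional b' 'X^i = modp_functional b 'X^i * (x - y).
    rewrite /modp_functional mulr_suml; apply: eq_bigr => j _.
    by rewrite ffunE; ring.
  exact: vers_ge_lift.
rewrite sumr_const -[_ *+ _]mulr_natl ler_wpM2r ?expR_ge0 // ler_nat.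
by rewrite (leq_trans (max_card _)) // card_ffun card_Fp // card_ord.
Qed.

Definition unif_monic (i : 'I_n.+1) (x : F) : R :=
  if i == ord_max then (x == 1)%:R else p%:R^-1.

Lemma unif_monic_ge0 i x : 0 <= unif_monic i x.
Proof. by rewrite /unif_monic; case: ifP => _; rewrite ?ler0n // invr_ge0 ler0n. Qed.

Lemma unif_monic_sum i : \sum_x unif_monic i x = 1.
Proof.
rewrite /unif_monic; case: (i == ord_max); last first.
  by rewrite sumr_const card_Fp // -(mulr_natl (p%:R^-1) p) divff // pR_neq0.
by rewrite (bigD1 1) //= ?eqxx big1 ?addr0 // => x /negPf ->.
Qed.

(** A nonzero functional is nonzero at some ['X^j] with [j < deg D <= n], where the coefficient is
    uniform and its characteristic function vanishes; so there is no error at all. *)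
Lemma wprob_unif_dvdp (D : {poly F}) : D != 0 -> (size D <= n.+1)%N ->
  (p ^ (size D).-1)%:R * wprob unif_monic (fun g => D %| g) = 1.
Proof.
move=> nzD szD; apply/eqP; rewrite -subr_eq0 -normr_eq0 eq_le normr_ge0 andbT.
apply: (le_trans (wprob_dvdp_dist p_pr nzD unif_monic_sum)).
rewrite big1 // => b nb; have [j nj bj] := modp_functional_neq0 nb.
have ltj : (j < n)%N.
  move: (nat_of_ord j) (ltn_ord j) szD => k; case: (size D) => // s h1.
  by rewrite ltnS; exact: leq_trans h1.
pose i : 'I_n.+1 := widen_ord (leqnSn n) (Ordinal ltj).
rewrite (bigD1 i) //= bj.
suff -> : charfun (unif_monic i) (b j) = 0 by rewrite normc0 mul0r.
have ni : (i == ord_max) = false by rewrite -val_eqE /= ltn_eqF.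
rewrite /charfun /unif_monic ni -mulr_sumr sum_expF //.
by rewrite (negPf nj) mulr0.
Qed.

(** Jensen's inequality for the weights [w a / T], via the tangent line of [exp] at [- S]. It turns
    the exponential of a sum into an average of exponentials that can be treated one at a time. *)
Lemma jensen_exp (I : finType) (w c : I -> R) (T : R) :
  (forall a, 0 <= w a) -> 0 < \sum_a w a -> T = \sum_a w a ->
  expR (- (\sum_a w a * c a)) <= (\sum_a w a * expR (- (T * c a))) / T.
Proof.
move=> w0 T0 eT; rewrite -eT in T0.
rewrite ler_pdivlMr // mulrC; set S := \sum_a w a * c a.
apply: (@le_trans _ _ (\sum_a w a * (expR (- S) * (1 + (S - T * c a))))).
  rewrite (eq_bigr (fun a => expR (- S) * (w a * (1 + S) - T * (w a * c a)))); last by move=> a _; ring.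
  rewrite -mulr_sumr sumrB -mulr_suml -mulr_sumr -/S -eT.
  by rewrite le_eqVlt; apply/orP; left; apply/eqP; ring.
apply: ler_sum => a _; rewrite ler_wpM2l //.
rewrite [leRHS](_ : _ = expR (- S + (S - T * c a))); last by congr expR; ring.
by rewrite expRD; apply: ler_wpM2l; rewrite ?expR_ge0 ?expR_ge1Dx.
Qed.

(** By [exp u >= 1 + u], the term of [t] is at most [1 / (1 + s^2 a^2)] with
    [a = |centered_lift t|]; each [a > 0] occurs at most twice. *)
Lemma sum_exp_vers_le (T : R) : 0 < T ->
  \sum_(t : F) expR (- (T * vers R t)) <= 1 + 4 * p%:R / Num.sqrt (2 * T).
Proof.
move=> T0; have p0 : 0 < p%:R :> R by rewrite ltr0n prime_gt0.
set s : R := Num.sqrt (2 * T) / p%:R.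
have T20 : 0 < 2 * T by rewrite mulr_gt0.
have s0 : 0 < s by rewrite divr_gt0 // sqrtr_gt0.
pose g (a : nat) : R := (1 + s ^+ 2 * a%:R ^+ 2)^-1.
have g0 a : 0 <= g a by rewrite invr_ge0 addr_ge0 // mulr_ge0 ?sqr_ge0.
have gE (t : F) : expR (- (T * vers R t)) <= if (2 * t < p)%N then g t else g (p - t)%N.
  have gle (a : nat) : `|centered_lift t| = a -> expR (- (T * vers R t)) <= g a.
    move=> ea; rewrite expRN lef_pV2 ?posrE ?expR_gt0 ?ltr_wpDr ?mulr_ge0 ?sqr_ge0 //.
    apply: le_trans (expR_ge1Dx _); rewrite lerD2l.
    apply: le_trans (ler_wpM2l (ltW T0) (vers_ge_lift R p_pr t)).
    have -> : ((centered_lift t)%:~R / p%:R) ^+ 2 = a%:R ^+ 2 / p%:R ^+ 2 :> R.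
      rewrite expr_div_n; congr (_ / _).
      by rewrite -real_normK ?num_real // -intr_norm ea -pmulrn.
    rewrite /s expr_div_n sqr_sqrtr ?(ltW T20) // le_eqVlt; apply/orP; left; apply/eqP.
    by field; rewrite gt_eqF.
  have tp : (t < p)%N by rewrite -[ltnRHS](Fp_cast p_pr) ltn_ord.
  case: ifP => h; apply: gle; rewrite /centered_lift h; lia.
(* Adding both values removes the case split; the reflection [t -> p - t] then makes the two sums
   equal. *)
have {}gE (t : F) : expR (- (T * vers R t)) <= g t + (if (t : nat) == 0%N then 0 else g (p - t)%N).
  apply: (le_trans (gE t)); case: ifP => h; case: ifP => h0; rewrite ?addr0 ?lerDl ?lerDr //.
  by move/eqP: h0 h => ->; rewrite muln0 prime_gt0.
apply: (@le_trans _ _ (\sum_(t : F) (g t + (if (t : nat) == 0%N then 0 else g (p - t)%N)))).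
  by apply: ler_sum => t _; exact: gE.
have -> : \sum_(t : F) (g t + (if (t : nat) == 0%N then 0 else g (p - t)%N)) =
    \sum_(0 <= t < p) (g t + (if t == 0%N then 0 else g (p - t)%N)).
  by rewrite -(big_mkord xpredT (fun t => g t + (if t == 0%N then 0 else g (p - t)%N))) Fp_cast.
have {}p_gt0 := prime_gt0 p_pr.
rewrite big_ltn // eqxx addr0 [g 0]/g expr0n mulr0 addr0 invr1 lerD2l.
have -> : \sum_(1 <= t < p) (g t + (if t == 0%N then 0 else g (p - t)%N)) =
   2 * \sum_(1 <= t < p) g t.
  have e : \sum_(1 <= t < p) (if t == 0%N then 0 else g (p - t)%N) = \sum_(1 <= t < p) g t.
    rewrite [RHS]big_nat_rev /=; apply: eq_big_nat => t /andP[t0 tp].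
    by rewrite gtn_eqF //; congr g; lia.
  by rewrite big_split /= e mulr_natl mulr2n.
have := sum_inv_sqr_le p.-1 s0; rewrite prednK // => h.
apply: (@le_trans _ _ (2 * (2 / s))); first by rewrite ler_wpM2l.
rewrite /s le_eqVlt; apply/orP; left; apply/eqP; field.
by rewrite !gt_eqF // sqrtr_gt0.
Qed.

End Equidistribution.

(** * Anticoncentration *)

Section Anticoncentration.
Variables (R : realType) (p : nat).
Hypothesis p_pr : prime p.
Variable n : nat.
Local Notation F := 'F_p.

(** Evaluation at a [g] that is nonzero modulo [D] is a nonzero linear form in [b], whose kernel has
    index [p]; characters do the counting. *)
Lemma card_functional_eq0 (D g : {poly F}) : D != 0 -> ~~ (D %| g) ->
  (p * #|[set b : {ffun 'I_(size D).-1 -> F} | modp_functional b g == 0%R]| = p ^ (size D).-1)%N.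
Proof.
move=> nzD nDg; set Z := [set b | _].
have : (p * #|Z|)%:R = (p ^ (size D).-1)%:R :> R[i].
  transitivity (\sum_(b : {ffun 'I_(size D).-1 -> F}) \sum_t expF R (t * modp_functional b g)).
    rewrite (eq_bigr (fun b => if b \in Z then p%:R else 0)); last first.
      by move=> b _; rewrite sum_expF // inE.
    by rewrite -big_mkcond sumr_const natrM mulr_natr.
  rewrite exchange_big /= (bigD1 0) //= [X in _ + X]big1 ?addr0 => [|t nt].
    rewrite (eq_bigr (fun=> 1)) => [|b _]; last by rewrite mul0r expF0.
    by rewrite sumr_const card_ffun card_Fp // card_ord.
  rewrite (eq_bigr (fun b => expF R (modp_functional b (t *: g)))) => [|b _]; last first.
    by rewrite modp_functionalZ.
  by rewrite sum_expF_modp // dvdpZr // (negPf nDg) mulr0.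
by move/eqP; rewrite eqr_nat => /eqP.
Qed.

(** Averaging: each ['X^i] is killed by a fraction [1/p <= 1/2] of the functionals, so some
    functional kills at most half of the ['X^i]. *)
Lemma exists_functional_nonzero (D : {poly F}) : D != 0 -> (forall j, ~~ (D %| 'X^j)) ->
  exists b : {ffun 'I_(size D).-1 -> F},
    (n.+1 <= 2 * #|[set i : 'I_n.+1 | modp_functional b 'X^i != 0%R]|)%N.
Proof.
move=> nzD nDX; apply: contrapT => hN.
have h b : (n.+1 < 2 * #|[set i : 'I_n.+1 | modp_functional (D := D) b 'X^i == 0%R]|)%N.
  have lt : (2 * #|[set i : 'I_n.+1 | modp_functional (D := D) b 'X^i != 0%R]| < n.+1)%N.
    by rewrite ltnNge; apply/negP => le; apply: hN; exists b.
  have := cardsC [set i : 'I_n.+1 | modp_functional (D := D) b 'X^i == 0%R].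
  rewrite card_ord (_ : ~: _ = [set i : 'I_n.+1 | modp_functional (D := D) b 'X^i != 0%R]).
    lia.
  by apply/setP => i; rewrite !inE.
pose T := {ffun 'I_(size D).-1 -> F}.
have e : (\sum_(b : T) #|[set i : 'I_n.+1 | modp_functional (D := D) b 'X^i == 0%R]| =
         \sum_(i < n.+1) #|[set b : T | modp_functional (D := D) b 'X^i == 0%R]|)%N.
  rewrite (eq_bigr (fun b : T => \sum_(i < n.+1) (modp_functional (D := D) b 'X^i == 0%R : nat))%N).
    rewrite exchange_big /=; apply: eq_bigr => i _.
    by rewrite -sum1_card [RHS]big_mkcond /=; apply: eq_bigr => b _; rewrite inE; case: ifP.
  by move=> b _; rewrite -sum1_card [LHS]big_mkcond /=; apply: eq_bigr => i _; rewrite inE; case: ifP.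
have h1 : (\sum_(b : T) n.+1 <
    \sum_(b : T) 2 * #|[set i : 'I_n.+1 | modp_functional (D := D) b 'X^i == 0%R]|)%N.
  rewrite [ltnLHS](bigD1 (0 : T)) // [ltnRHS](bigD1 (0 : T)) //= -addSn leq_add //.
  by apply: leq_sum => b _; rewrite ltnW.
move: h1; rewrite -big_distrr /= e sum_nat_const card_ffun card_Fp // card_ord.
have h2 : (p * \sum_(i < n.+1) #|[set b : T | modp_functional (D := D) b 'X^i == 0%R]| =
     n.+1 * p ^ (size D).-1)%N.
  rewrite big_distrr /= (eq_bigr (fun=> p ^ (size D).-1)%N) ?sum_nat_const ?card_ord // => i _.
  exact: card_functional_eq0.
have p_gt1 := prime_gt1 p_pr.
set s := (\sum_(i < n.+1) _)%N in h2 * => h1.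
have : (2 * s <= p * s)%N by rewrite leq_mul2r p_gt1 orbT.
by rewrite h2 => /(leq_trans h1); rewrite mulnC ltnn.
Qed.

(** If [D] divides [f] then [psi f = 0], where [psi] is nonzero on at least half of the ['X^i]. In
    the Fourier sum over [t], Jensen's inequality replaces the product over [i] by an average of
    [exp (- T vers (t * z a))] with [z a != 0]. Summing over [t] first, the permutation
    [t -> t * z a] of the field makes all these terms equal. *)
Lemma wprob_dvdp_le (mu : F -> R) (eta : R) (D : {poly F}) :
  (forall x, 0 <= mu x) -> \sum_x mu x = 1 -> 0 < eta ->
  eta <= \sum_x \sum_(y | y != x) mu x * mu y -> D != 0 ->
  (forall j, ~~ (D %| 'X^j)) ->
  wprob (n := n) (fun=> mu) (fun g => D %| g) <=
    p%:R^-1 + 4 / Num.sqrt (eta * n.+1%:R / 2).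
Proof.
move=> mu0 mu1 eta0 eta_le nzD nDX.
have [b bM] := exists_functional_nonzero nzD nDX.
set M := #|_| in bM.
pose psi := modp_functional (D := D) b.
have p0 : 0 < p%:R :> R by rewrite ltr0n prime_gt0.
set eta' := \sum_x _ in eta_le.
apply: (@le_trans _ _ (\sum_c weight (n := n) (fun=> mu) c * (psi (coef_poly c) == 0)%:R)).
  apply: ler_sum => c _; rewrite ler_wpM2l ?weight_ge0 // ler_nat.
  have [/modp_eq0P Dc|] := boolP (D %| _); last by [].
  by rewrite /psi /modp_functional Dc big1 ?eqxx // => j _; rewrite coef0 mulr0.
set Pr := \sum_c _.
have PrE : ((p%:R * Pr)%:C)%C = \sum_t \prod_(i < n.+1) charfun mu (t * psi 'X^i).
  transitivity (\sum_t \sum_c (weight (n := n) (fun=> mu) c)%:C%C * expF R (t * psi (coef_poly c))).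
    rewrite exchange_big /= /Pr mulr_sumr rmorph_sum; apply: eq_bigr => c _.
    rewrite -mulr_sumr sum_expF // mulrCA rmorphM /=; congr (_ * _).
    by case: eqP => _; rewrite ?mulr1 ?mulr0 ?rmorph0 // rmorph_nat.
  apply: eq_bigr => t _; exact: (sum_weight_expF p_pr (fun=> mu) (modp_functional b)).
(* One index for each position and pair of coefficient values; [act] selects those with [z]
   nonzero. *)
pose I : finType := ('I_n.+1 * (F * F))%type.
pose act (a : I) := (psi 'X^(a.1) != 0) && (a.2.2 != a.2.1).
pose w (a : I) : R := if act a then mu a.2.1 * mu a.2.2 / 2 else 0.
pose z (a : I) : F := psi 'X^(a.1) * (a.2.1 - a.2.2).
have w0 a : 0 <= w a by rewrite /w; case: ifP => // _; rewrite divr_ge0 // mulr_ge0.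
have sumI (f : I -> R) : \sum_a f a = \sum_(i < n.+1) \sum_x \sum_y f (i, (x, y)).
  rewrite (pair_bigA _ (fun (i : 'I_n.+1) x => \sum_y f (i, (x, y)))) /=.
  rewrite (pair_bigA _ (fun (ix : 'I_n.+1 * F) y => f (ix.1, (ix.2, y)))) /=.
  rewrite (reindex (fun q : 'I_n.+1 * F * F => (q.1.1, (q.1.2, q.2)))) //=.
  by exists (fun a : I => (a.1, a.2.1, a.2.2)) => [[[]]|[? []]].
pose T := \sum_a w a.
have TE : T = M%:R * eta' / 2.
  rewrite /T sumI (eq_bigr (fun i : 'I_n.+1 => if psi 'X^i != 0 then eta' / 2 else 0)).
    rewrite -big_mkcond /= sumr_const -(mulr_natl (eta' / 2)) mulrA.
    by congr (_%:R * _ / _); apply: eq_card => i; rewrite !inE.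
  move=> i _; case: ifPn => [ni|/negPn/eqP ni].
    rewrite /eta' mulr_suml; apply: eq_bigr => x _.
    rewrite mulr_suml [RHS]big_mkcond /=; apply: eq_bigr => y _.
    by rewrite /w /act /= ni.
  by rewrite big1 // => x _; rewrite big1 // => y _; rewrite /w /act /= ni eqxx.
have M0 : (0 < M)%N by lia.
have eta'0 : 0 < eta' by exact: lt_le_trans eta_le.
have T0 : 0 < T by rewrite TE divr_gt0 // mulr_gt0 // ltr0n.
have bound t : normc (\prod_(i < n.+1) charfun mu (t * psi 'X^i)) <=
    (\sum_a w a * expR (- (T * vers R (t * z a)))) / T.
  rewrite normc_prod; apply: (le_trans (prod_charfun_le p_pr (fun i : 'I_n.+1 => t * psi 'X^i) mu0 mu1)).
  apply: (le_trans _ (jensen_exp (fun a => vers R (t * z a)) w0 T0 erefl)).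
  rewrite ler_expR mulNr lerN2 sumI.
  rewrite (eq_bigr (fun i : 'I_n.+1 => \sum_x \sum_y w (i, (x, y)) * vers R (t * (psi 'X^i * (x - y))))) //.
  rewrite exchange_big /= mulr_suml; apply: ler_sum => x _.
  rewrite exchange_big /= mulr_suml; apply: ler_sum => y _.
  rewrite mulr_sumr mulr_suml; apply: ler_sum => i _.
  rewrite mulrA /w; case: ifP => _; last by rewrite mul0r !mulr_ge0 ?invr_ge0 ?vers_ge0.
  by rewrite /= mulrAC lexx.
have pPr : p%:R * Pr <= \sum_(t : F) expR (- (T * vers R t)).
  have Pr0 : 0 <= Pr by rewrite sumr_ge0 // => c _; rewrite mulr_ge0 ?weight_ge0.
  rewrite -[leLHS]ger0_norm ?mulr_ge0 // -normc_real PrE.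
  apply: (le_trans (normc_sum _ _ _)).
  apply: (@le_trans _ _ (\sum_t (\sum_a w a * expR (- (T * vers R (t * z a)))) / T)).
    by apply: ler_sum => t _; exact: bound.
  rewrite -mulr_suml exchange_big /= ler_pdivrMr // mulrC /T mulr_suml.
  rewrite le_eqVlt; apply/orP; left; apply/eqP; apply: eq_bigr => a _.
  rewrite -mulr_sumr /w; case: ifP => [/andP[n1 n2]|_]; last by rewrite !mul0r.
  congr (_ * _); have nz : z a != 0 by rewrite mulf_neq0 // subr_eq0 eq_sym.
  by rewrite [RHS](reindex_inj (mulIf nz)).
have := le_trans pPr (sum_exp_vers_le p_pr T0).
have -> : 1 + 4 * p%:R / Num.sqrt (2 * T) = p%:R * (p%:R^-1 + 4 / Num.sqrt (2 * T)).
  by field; rewrite !gt_eqF // sqrtr_gt0 mulr_gt0.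
rewrite ler_pM2l // => /le_trans; apply; rewrite lerD2l ler_wpM2l //.
rewrite lef_pV2 ?posrE ?sqrtr_gt0 ?mulr_gt0 ?invr_gt0 ?ltr0n //.
rewrite ler_sqrt; last by rewrite mulr_ge0 // ltW.
rewrite TE.
have hM : n.+1%:R <= 2 * M%:R :> R by rewrite -natrM ler_nat.
have -> : 2 * (M%:R * eta' / 2) = M%:R * eta' by field.
have : eta * n.+1%:R <= eta' * (2 * M%:R) by rewrite ler_pM ?ler0n // ltW.
lra.
Qed.

End Anticoncentration.

(** * Truncated inclusion-exclusion *)

Lemma sum_prod_subsets (A : comNzRingType) (I : finType) (a : I -> A) :
  \sum_(T : {set I}) \prod_(i in T) a i = \prod_i (1 + a i).
Proof.
rewrite (eq_bigr (fun i => a i + 1)) => [|i _]; last by rewrite addrC.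
rewrite bigA_distr; apply: eq_bigr => T _.
by rewrite big_mkcond.
Qed.

Lemma sum_exp_card_subsets (A : comNzRingType) (I : finType) (V : {set I}) (a : A) :
  \sum_(T : {set I} | T \subset V) a ^+ #|T| = (1 + a) ^+ #|V|.
Proof.
rewrite -prodr_const [RHS]big_mkcond /=.
rewrite [RHS](eq_bigr (fun i => 1 + (if i \in V then a else 0))); last first.
  by move=> i _; case: ifP => _; rewrite ?addr0.
rewrite -sum_prod_subsets big_mkcond; apply: eq_bigr => T _.
case: ifPn => [/fintype.subsetP TV|/fintype.subsetPn[i iT iV]].
  by rewrite -prodr_const; apply: eq_bigr => i /TV ->.
by rewrite (bigD1 i) //= (negPf iV) mul0r.
Qed.

(** The sum factorises over the elements of [I], and an element at which [S] and [V] differ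
    contributes the factor [0]. *)
Lemma moebius_subsets (A : comNzRingType) (I : finType) (S V : {set I}) :
  \sum_(T : {set I} | (S \subset T) && (T \subset V)) (-1) ^+ #|T :\: S| = (S == V)%:R :> A.
Proof.
have -> : (S == V)%:R = \prod_i ((if i \in V then (if i \in S then 1 else -1) else 0) +
    (if i \in S then 0 else 1)) :> A.
  case: eqP => [->|neq].
    by rewrite big1 // => i _; case: (i \in V); rewrite ?addr0 ?add0r.
  have [i hi] : exists i, (i \in S) != (i \in V).
    apply: contrapT => h; apply: neq; apply/setP => i; apply/eqP/negPn/negP => h'.
    by apply: h; exists i.
  rewrite (bigD1 i) //=; move: hi; case: (i \in S); case: (i \in V) => // _.
    by rewrite addr0 mul0r.
  by rewrite addNr mul0r.
rewrite bigA_distr big_mkcond; apply: eq_bigr => T _.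
have [/andP[/fintype.subsetP ST /fintype.subsetP TV]|] := ifPn.
  rewrite -prodr_const big_mkcond; apply: eq_bigr => i _; rewrite inE.
  have [iT|iT] := boolP (i \in T); first by rewrite TV //= andbT; case: (i \in S).
  by rewrite andbF; case: ifP => // /ST; rewrite (negPf iT).
rewrite negb_and => /orP[/fintype.subsetPn[i iS iT]|/fintype.subsetPn[i iT iV]].
  by rewrite (bigD1 i) //= (negPf iT) iS mul0r.
by rewrite (bigD1 i) //= iT (negPf iV) mul0r.
Qed.

Lemma extend_subset (I : finType) (T V : {set I}) k :
  T \subset V -> (#|T| <= k <= #|V|)%N ->
  exists T' : {set I}, [/\ T \subset T', T' \subset V & #|T'| = k].
Proof.
move=> TV /andP[Tk kV]; pose s := take (k - #|T|) (enum (V :\: T)).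
have sub i : i \in s -> i \in V :\: T by move/mem_take; rewrite mem_enum.
exists (T :|: [set i in s]); split; first exact: finset.subsetUl.
  apply/fintype.subsetP => i; rewrite !inE => /orP[/(fintype.subsetP TV)//|/sub].
  by rewrite inE => /andP[].
have dis : [disjoint T & [set i in s]].
  rewrite -finset.setI_eq0; apply/eqP/setP => i; rewrite !inE.
  by apply/negbTE/negP => /andP[iT /sub]; rewrite inE iT.
rewrite cardsU (disjoint_setI0 dis) cards0 subn0 cardsE (card_uniqP _) ?take_uniq ?enum_uniq //.
by rewrite size_take -cardE cardsD (finset.setIidPr TV); case: ifP; lia.
Qed.

Section Truncated.
Variables (R : realFieldType) (Omega I : finType).
Variables (w : Omega -> R) (W : Omega -> {set I}) (x : I -> R) (k : nat) (eps : R).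
Hypotheses (w0 : forall o, 0 <= w o) (x0 : forall i, 0 <= x i) (eps0 : 0 <= eps).

Let inclP (T : {set I}) : R := \sum_o w o * (T \subset W o)%:R.
Let lawP (S : {set I}) : R := \sum_o w o * (W o == S)%:R.
Let prodx (T : {set I}) : R := \prod_(i in T) x i.

Hypothesis incl_close : forall T : {set I}, (#|T| <= k)%N ->
  `|inclP T - prodx T| <= eps * prodx T.

(** Inclusion-exclusion cut at size [k], for a random set containing each [i] independently with
    probability [x i]. Possibly signed, it depends on [x] and [k] only and so serves as common
    reference for both polynomials. *)
Definition truncated_law (S : {set I}) : R :=
  \sum_(T : {set I} | (S \subset T) && (#|T| <= k)%N) (-1) ^+ #|T :\: S| * \prod_(i in T) x i.

Let err (S V : {set I}) : R :=
  (V == S)%:R - \sum_(T : {set I} | (S \subset T) && (#|T| <= k)%N)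
     (-1) ^+ #|T :\: S| * (T \subset V)%:R.

(** For [#|V| <= k] inclusion-exclusion is exact. Otherwise each [T] of size at most [k] in [V] is
    counted for its [2^#|T|] subsets [S] and extends to a [k]-subset of [V]; a [k]-set has total
    [\sum 2^#|T| = 3^k] over its subsets. *)
Lemma sum_err_le V : \sum_S `|err S V| <=
  (1 + 3 ^+ k) * \sum_(T : {set I} | #|T| == k) (T \subset V)%:R.
Proof.
have [Vk|kV] := leqP #|V| k.
  rewrite big1 => [|S _].
    by rewrite mulr_ge0 ?addr_ge0 ?exprn_ge0 // sumr_ge0 // => T _; rewrite ler0n.
  rewrite /err eq_sym -moebius_subsets; apply/eqP; rewrite normr_eq0 subr_eq0; apply/eqP.
  rewrite big_mkcond [RHS]big_mkcond; apply: eq_bigr => T _.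
  case: (S \subset T) => //=; have [TV|_] := boolP (T \subset V).
    by rewrite (leq_trans (subset_leq_card TV)) // mulr1.
  by rewrite mulr0; case: ifP.
set C : R := \sum_(T : {set I} | #|T| == k) (T \subset V)%:R.
have main : \sum_(T : {set I} | (T \subset V) && (#|T| <= k)%N) 2 ^+ #|T| <= 3 ^+ k * C.
  rewrite /C mulr_sumr.
  have -> : \sum_(T' : {set I} | #|T'| == k) 3 ^+ k * (T' \subset V)%:R =
      \sum_(T' : {set I} | #|T'| == k) \sum_(T : {set I} | T \subset T')
        2 ^+ #|T| * (T' \subset V)%:R :> R.
    apply: eq_bigr => T' /eqP cT'; rewrite -mulr_suml sum_exp_card_subsets cT'.
    by congr (_ ^+ _ * _); ring.
  rewrite (exchange_big_dep xpredT) //= big_mkcond; apply: ler_sum => T _.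
  have nn (T' : {set I}) : 0 <= 2 ^+ #|T| * (T' \subset V)%:R :> R.
    by rewrite mulr_ge0 ?exprn_ge0.
  case: ifPn => [/andP[TV Tk]|_]; last by rewrite sumr_ge0.
  have [T' [TT' T'V cT']] := @extend_subset _ T V k TV (introT andP (conj Tk (ltnW kV))).
  rewrite (bigD1 T') /=; last by rewrite cT' eqxx.
  by rewrite T'V mulr1 lerDl sumr_ge0.
have C1 : 1 <= C.
  have k0 : (#|(finset.set0 : {set I})| <= k <= #|V|)%N by rewrite cards0 (ltnW kV).
  have [T' [_ T'V cT']] := extend_subset (finset.sub0set V) k0.
  rewrite /C (bigD1 T') /=; last by rewrite cT' eqxx.
  by rewrite T'V lerDl sumr_ge0.
apply: (@le_trans _ _ (1 + \sum_(T : {set I} | (T \subset V) && (#|T| <= k)%N) 2 ^+ #|T|)); last first.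
  by rewrite mulrDl mul1r lerD.
apply: (@le_trans _ _ (\sum_(S : {set I}) ((V == S)%:R +
    \sum_(T : {set I} | (S \subset T) && (#|T| <= k)%N) (T \subset V)%:R))).
  apply: ler_sum => S _; apply: (le_trans (ler_normB _ _)).
  rewrite ger0_norm ?ler0n // lerD2l; apply: (le_trans (ler_norm_sum _ _ _)).
  by apply: ler_sum => T _; rewrite normrM normrX normrN1 expr1n mul1r ger0_norm.
rewrite big_split /= lerD //.
  by rewrite (bigD1 V) //= eqxx big1 ?addr0 // => S /negPf; rewrite eq_sym => ->.
rewrite (exchange_big_dep xpredT) //= [leRHS]big_mkcond; apply: ler_sum => T _.
have [TV|_] := boolP (T \subset V) => /=; last by rewrite big1.
case: (leqP #|T| k) => Tk; last by rewrite big1 // => S; rewrite andbF.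
have := sum_exp_card_subsets T (1 : R); rewrite -[1 + 1]/(2%:R) => <-.
rewrite le_eqVlt; apply/orP; left; apply/eqP; apply: eq_big => S; first by rewrite andbT.
by rewrite expr1n.
Qed.

(** The intermediate [mid] keeps the true inclusion probabilities: replacing them by products costs
    the first term, truncation the second. *)
Lemma truncated_law_close :
  \sum_S `|lawP S - truncated_law S| <=
    eps * \prod_i (1 + 2 * x i) +
    (1 + 3 ^+ k) * (1 + eps) * \sum_(T : {set I} | #|T| == k) \prod_(i in T) x i.
Proof.
have prodx0 T : 0 <= prodx T by apply: prodr_ge0.
pose mid (S : {set I}) := \sum_(T : {set I} | (S \subset T) && (#|T| <= k)%N) (-1) ^+ #|T :\: S| * inclP T.
apply: (@le_trans _ _ (\sum_S (`|lawP S - mid S| + `|mid S - truncated_law S|))).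
  by apply: ler_sum => S _; rewrite ler_distD.
rewrite big_split /= [leLHS]addrC; apply: lerD.
- apply: (@le_trans _ _ (\sum_(S : {set I}) \sum_(T : {set I} | (S \subset T) && (#|T| <= k)%N) eps * prodx T)).
    apply: ler_sum => S _; rewrite /mid /truncated_law -sumrB.
    apply: (le_trans (ler_norm_sum _ _ _)); apply: ler_sum => T /andP[_ Tk].
    by rewrite -mulrBr normrM normrX normrN1 expr1n mul1r incl_close.
  rewrite (exchange_big_dep xpredT) //= -sum_prod_subsets mulr_sumr.
  apply: ler_sum => T _; rewrite big_split /= prodr_const -/(prodx T).
  apply: (@le_trans _ _ (\sum_(S : {set I} | S \subset T) eps * prodx T)).
    rewrite [leRHS]big_mkcond [leLHS]big_mkcond; apply: ler_sum => S _.
    case: (S \subset T) => //=; case: ifP => // _; exact: mulr_ge0.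
  have := sum_exp_card_subsets T (1 : R); rewrite -[1 + 1]/(2%:R) => <-.
  rewrite mulrCA mulr_suml le_eqVlt; apply/orP; left; apply/eqP.
  by apply: eq_bigr => S _; rewrite expr1n mul1r.
have eqE S : lawP S - mid S = \sum_o w o * err S (W o).
  rewrite /lawP /mid /inclP.
  under [X in _ - X]eq_bigr do rewrite mulr_sumr.
  rewrite exchange_big /= -sumrB; apply: eq_bigr => o _.
  rewrite /err mulrBr; congr (_ - _); rewrite mulr_sumr; apply: eq_bigr => T _.
  by rewrite mulrCA.
apply: (@le_trans _ _ (\sum_(S : {set I}) \sum_o w o * `|err S (W o)|)).
  apply: ler_sum => S _; rewrite eqE; apply: (le_trans (ler_norm_sum _ _ _)).
  by apply: ler_sum => o _; rewrite normrM ger0_norm.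
rewrite exchange_big /=.
apply: (@le_trans _ _ (\sum_o w o * ((1 + 3 ^+ k) * \sum_(T : {set I} | #|T| == k) (T \subset W o)%:R))).
  by apply: ler_sum => o _; rewrite -mulr_sumr ler_wpM2l // sum_err_le.
rewrite (eq_bigr (fun o => (1 + 3 ^+ k) * \sum_(T : {set I} | #|T| == k) w o * (T \subset W o)%:R)); last first.
  by move=> o _; rewrite -mulr_sumr mulrCA.
rewrite -mulr_sumr -mulrA; apply: ler_wpM2l; first by rewrite addr_ge0 ?exprn_ge0.
rewrite exchange_big /= mulr_sumr.
apply: ler_sum => T /eqP cT.
have := incl_close (eq_leq cT); rewrite -/(inclP T) -/(prodx T) mulrDl mul1r => h.
by rewrite -lerBlDl (le_trans (ler_norm _)).
Qed.

End Truncated.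

(** Rankin's trick: weight each [T] by [y^(#|T| - k)] and sum over all subsets. *)
Lemma sum_prod_card_le (R : realType) (I : finType) (x : I -> R) k (y : R) : 0 < y ->
  (forall i, 0 <= x i) ->
  \sum_(T : {set I} | #|T| == k) \prod_(i in T) x i <= y ^- k * expR (y * \sum_i x i).
Proof.
move=> y0 x0; rewrite mulrC ler_pdivlMr ?exprn_gt0 // mulr_suml.
apply: (@le_trans _ _ (\sum_(T : {set I}) \prod_(i in T) (y * x i))).
  rewrite big_mkcond; apply: ler_sum => T _; rewrite big_split /= prodr_const.
  case: ifP => [/eqP ->|_]; first by rewrite mulrC.
  by rewrite mulr_ge0 ?exprn_ge0 ?prodr_ge0 // ltW.
rewrite sum_prod_subsets mulr_sumr expR_sum; apply: ler_prod => i _.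
by rewrite expR_ge1Dx andbT addr_ge0 // mulr_ge0 // ltW.
Qed.

Lemma prod_1D_le (R : realType) (I : finType) (x : I -> R) (y : R) : 0 <= y ->
  (forall i, 0 <= x i) -> \prod_i (1 + y * x i) <= expR (y * \sum_i x i).
Proof.
move=> y0 x0; rewrite mulr_sumr expR_sum; apply: ler_prod => i _.
by rewrite expR_ge1Dx andbT addr_ge0 // mulr_ge0.
Qed.

(** * Laws of the random polynomials *)

Section RandomPoly.
Variables (R : realType) (p : nat) (p_pr : prime p) (n : nat).
Local Notation F := 'F_p.

Lemma coef_poly_inj : injective (@coef_poly p n).
Proof.
move=> c c' e; apply/ffunP => i.
have := congr1 (fun g : {poly F} => g`_i) e; rewrite /coef_poly.
by rewrite !coef_sum_ord.
Qed.

Lemma prob_iid_poly (mu : probability F R) (d : measure_display)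
    (T : measurableType d) (P : probability T R) (eps : 'I_n.+1 -> {RV P >-> F})
    (B : set {poly F}) :
  mutually_independent eps ->
  (forall i, distribution P (eps i) = mu :> (set F -> \bar R)) ->
  P ((fun o => \sum_(i < n.+1) eps i o *: 'X^i) @^-1` B)%classic =
  (wprob (n := n) (fun _ x => fine (mu [set x]%classic)) (fun g => `[< B g >]))%:E.
Proof.
move=> indep law; pose C : finType := {ffun 'I_n.+1 -> F}.
pose E (c : C) : set T := (\bigcap_(i in [set` [set: 'I_n.+1]%SET]) (eps i @^-1` [set c i]))%classic.
have mpre (i : 'I_n.+1) (x : F) : measurable (eps i @^-1` [set x])%classic.
  by rewrite -[X in measurable X]setTI; exact: measurable_funP.
have mE c : measurable (E c) by apply: fin_bigcap_measurable => // i _; exact: mpre.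
have muE x : mu [set x]%classic = (fine (mu [set x]%classic))%:E.
  by rewrite fineK // fin_num_measure.
have PE c : P (E c) = (weight (n := n) (fun _ x => fine (mu [set x]%classic)) c)%:E.
  rewrite /E indep => [|i _]; last by [].
  rewrite /weight (big_morph EFin EFinM erefl) big_mkcond; apply: eq_bigr => i _.
  by rewrite inE -muE -(law i).
have Eo o c : E c o <-> c = [ffun i => eps i o].
  split=> [Ec|-> i _]; last by rewrite /= ffunE.
  by apply/ffunP => i; rewrite ffunE -(Ec i) //= inE.
(* Coefficient vectors are numbered by ordinals, the index type of [measure_bigsetU_ord_cond]. *)
pose J := [pred j : 'I_#|C| | `[< B (coef_poly (enum_val j : C)) >]].
have -> : ((fun o => \sum_(i < n.+1) eps i o *: 'X^i) @^-1` B)%classic =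
    (\big[setU/set0]_(j in J) E (enum_val j))%classic.
  have cE o : coef_poly [ffun i => eps i o] = \sum_(i < n.+1) eps i o *: 'X^i.
    by apply: eq_bigr => i _; rewrite ffunE.
  rewrite -bigcup_pred; apply/seteqP; split=> o /=.
    move=> Bo; exists (enum_rank [ffun i => eps i o]); last by rewrite enum_rankK; apply/Eo.
    by rewrite /= inE enum_rankK cE; do 2! apply/asboolP.
  by case=> j; rewrite /= inE => /asboolP/asboolP Bj /Eo ej; rewrite -cE -ej.
rewrite measure_bigsetU_ord_cond; last 2 first.
- by move=> j _; exact: mE.
- by move=> i j _ _ [t [/Eo ei /Eo ej]]; apply: enum_val_inj; rewrite ei ej.
rewrite (eq_bigr (fun j =>
    (weight (n := n) (fun _ x => fine (mu [set x]%classic)) (enum_val j))%:E)); last first.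
  by move=> j _; exact: PE.
rewrite sumEFin; congr EFin.
rewrite -(@big_enum_val_cond _ _ _ C C (fun c => `[< B (coef_poly c) >])
  (fun c => weight (n := n) (fun _ x => fine (mu [set x]%classic)) c)).
rewrite /wprob big_mkcond /=; apply: eq_bigr => c _.
by case: asboolP; rewrite ?mulr1 ?mulr0.
Qed.

Lemma prob_unif_poly (d : measure_display) (T : measurableType d) (Q : probability T R)
    (fbar : {RV Q >-> {poly F}}) (B : set {poly F}) :
  uniformly_distributed fbar (@monic_of_degree F n) ->
  Q (fbar @^-1` B)%classic = (wprob (@unif_monic R p n) (fun g => `[< B g >]))%:E.
Proof.
move=> unif; pose C : finType := {ffun 'I_n.+1 -> F}.
pose A (B' : set {poly F}) := [set c : C | (c ord_max == 1) && `[< B' (coef_poly c) >]]%SET.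
have card B' : #|` fset_set (B' `&` @monic_of_degree F n)%classic| = #|A B'|.
  have -> : (B' `&` @monic_of_degree F n)%classic =
      [set` [fset coef_poly c | c in A B']%fset]%classic.
    apply/seteqP; split=> g /=.
      case=> Bg [mg szg]; apply/imfsetP.
      have gE : g = coef_poly [ffun i : 'I_n.+1 => g`_i].
        rewrite -[LHS]coefK poly_def szg; apply: eq_bigr => i _; by rewrite ffunE.
      exists [ffun i : 'I_n.+1 => g`_i] => //=.
      rewrite inE ffunE -gE; apply/andP; split; last exact/asboolP.
      by rewrite /= -[n]/(n.+1.-1) -szg -lead_coefE; exact: mg.
    case/imfsetP => c /=; rewrite inE => /andP[/eqP c1 /asboolP Bc] ->; split=> //.
    have cn : (coef_poly c)`_n = 1 by rewrite /coef_poly (coef_sum_ord c ord_max).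
    have szc : size (coef_poly c) = n.+1.
      apply/eqP; rewrite eqn_leq size_sum_ord ltnNge; apply/negP => h.
      by move: cn; rewrite nth_default // => /eqP; rewrite eq_sym oner_eq0.
    by split=> //; rewrite monicE lead_coefE szc /= cn.
  rewrite set_fsetK card_imfset /=; last exact: coef_poly_inj.
  by rewrite -cardE.
have wE c : weight (@unif_monic R p n) c = (c ord_max == 1)%:R * (p ^ n)%:R^-1.
  rewrite /weight big_ord_recr /= mulrC; congr (_ * _); first by rewrite /unif_monic eqxx.
  rewrite (eq_bigr (fun=> p%:R^-1)) => [|i _].
    by rewrite prodr_const card_ord natrX exprVn.
  by rewrite /unif_monic -val_eqE /= ltn_eqF.
have sumE (B' : set {poly F}) : wprob (@unif_monic R p n) (fun g => `[< B' g >]) = #|A B'|%:R * (p ^ n)%:R^-1.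
  rewrite /wprob (eq_bigr (fun c => if c \in A B' then (p ^ n)%:R^-1 else 0)).
    by rewrite -big_mkcond sumr_const mulr_natl.
  move=> c _; rewrite wE inE; case: eqP => _; case: asboolP => _;
    by rewrite ?mul1r ?mulr1 ?mulr0 ?mul0r.
(* Total mass [1] identifies the number of monic polynomials of degree [n] as [p^n]. *)
have tot : #|A setT|%:R * (p ^ n)%:R^-1 = 1 :> R.
  rewrite -sumE /wprob -[RHS](sum_weight (unif_monic_sum R p_pr (n := n))).
  by apply: eq_bigr => c _; rewrite asboolT // mulr1.
have pn0 : (p ^ n)%:R != 0 :> R by rewrite pnatr_eq0 expn_eq0 negb_and -lt0n prime_gt0.
have -> : Q (fbar @^-1` B)%classic = distribution Q fbar B by [].
rewrite unif // card -[X in fset_set X]setTI card sumE; congr EFin; congr (_ * _^-1).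
by rewrite -[LHS](divfK pn0) tot mul1r.
Qed.

End RandomPoly.

(** * Profiles and divisors of high order *)

Section HighOrder.
Variables (F : finFieldType) (N H : nat).

Definition high_order_irr : seq {poly F} := [seq phi <- irreducibles F N | ~~ low_order H phi].
Definition low_order_irr : seq {poly F} := [seq phi <- irreducibles F N | low_order H phi].
Definition hirr (i : 'I_(size high_order_irr)) : {poly F} := nth 0 high_order_irr i.
Definition hirr_prod (T : {set 'I_(size high_order_irr)}) : {poly F} := \prod_(i in T) hirr i.
Definition hirr_divisors (g : {poly F}) : {set 'I_(size high_order_irr)} :=
  [set i | hirr i %| g]%SET.

Lemma hirr_mem i : hirr i \in high_order_irr.
Proof. exact: mem_nth. Qed.

Lemma hirrP i : [/\ hirr i \is monic, irreducible_poly (hirr i), hirr i != 'X,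
  (size (hirr i) <= N.+1)%N & ~~ low_order H (hirr i)].
Proof. by have := hirr_mem i; rewrite mem_filter => /andP[nl /mem_irreducibles[]]. Qed.

Lemma hirr_inj : injective hirr.
Proof.
move=> i j /eqP; rewrite nth_uniq ?ltn_ord // ?filter_uniq ?irreducibles_uniq //.
by move=> /eqP e; exact: val_inj.
Qed.

Lemma sum_hirr (A : nmodType) (f : {poly F} -> A) :
  \sum_i f (hirr i) = \sum_(phi <- high_order_irr) f phi.
Proof. by rewrite (big_nth 0) big_mkord. Qed.

Lemma hirr_prod_dvdp T g : (hirr_prod T %| g) = (T \subset hirr_divisors g).
Proof.
rewrite /hirr_prod -big_enum /=.
rewrite -(big_map hirr xpredT id) /= prod_irreducible_dvdp.
- apply/allP/fintype.subsetP => [h i iT|h phi /mapP [i iT ->]].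
    by rewrite inE; apply: h; apply/mapP; exists i => //; rewrite mem_enum.
  by move: iT; rewrite mem_enum => /h; rewrite inE.
- by rewrite map_inj_uniq ?enum_uniq //; exact: hirr_inj.
- by move=> phi /mapP [i _ ->]; have [] := hirrP i.
Qed.

Lemma hirr_prod_monic T : hirr_prod T \is monic.
Proof. by apply: monic_prod => i _; have [] := hirrP i. Qed.

Lemma hirr_prod_size T :
  ((size (hirr_prod T)).-1 = \sum_(i in T) (size (hirr i)).-1)%N.
Proof.
rewrite size_prod; last by move=> i _; apply: monic_neq0; have [] := hirrP i.
rewrite (eq_bigr (fun i => (size (hirr i)).-1 + 1)%N).
  by rewrite big_split /= sum1_card subSn ?leq_addl //= addnK.
by move=> i _; have [_ [h _] _ _ _] := hirrP i; rewrite addn1 prednK // ltnW.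
Qed.

Lemma hirr_prod_size_le T : ((size (hirr_prod T)).-1 <= N * #|T|)%N.
Proof.
rewrite hirr_prod_size mulnC -sum_nat_const; apply: leq_sum => i _.
by have [_ _ _ h _] := hirrP i; case: (size (hirr i)) h.
Qed.

Lemma hirr_prod_good T (phi : {poly F}) : irreducible_poly phi -> phi %| hirr_prod T ->
  ~~ (phi %| 'X) /\ forall t, (0 < t <= H)%N -> ~~ (phi %| 'X^t - 1).
Proof.
move=> irr; rewrite /hirr_prod => dphi.
have [i _ di] : exists2 i, i \in T & phi %| hirr i.
  elim/big_rec: _ dphi => [|i g iT IH]; last first.
    by case/(irreducible_dvdM irr)/orP => [h|/IH//]; exists i.
  by rewrite dvdp1 => /eqP e; move: irr.1; rewrite e.
have [_ irri _ _ nl] := hirrP i.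
have eqi : phi %= hirr i.
  have [h|//] := irredp_XsubCP irri di.
  by move: irr.1; move: h; rewrite -size_poly_eq1 => /eqP ->.
rewrite (eqp_dvdl _ eqi); split=> [|t ht].
  have := hirr_mem i; rewrite mem_filter => /andP[_ /irreducible_ndvdXn h].
  exact: (h 1%N).
rewrite (eqp_dvdl _ eqi); apply: contra nl => d; apply/hasP; exists t => //.
by rewrite mem_iota; lia.
Qed.

Lemma profile_eq g g' : (forall phi, phi \in low_order_irr -> ~~ (phi %| g)) ->
  (forall phi, phi \in low_order_irr -> ~~ (phi %| g')) ->
  hirr_divisors g = hirr_divisors g' ->
  irr_divisor_profile N g = irr_divisor_profile N g'.
Proof.
move=> ng ng' eW; rewrite /irr_divisor_profile; apply: eq_from_tnth => i; rewrite !tnth_mktuple.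
rewrite /num_irr_divisors; congr (#|` fset_set _|).
have main h h' : (forall phi, phi \in low_order_irr -> ~~ (phi %| h)) ->
    hirr_divisors h = hirr_divisors h' ->
    (irr_divisors i.+1 h `<=` irr_divisors i.+1 h')%classic.
  move=> nh e phi [[mf szf] irr nX dh]; split=> //.
  have phiG : phi \in irreducibles F N.
    by apply/mem_irreducibles; split=> //; rewrite szf ltnS.
  have nl : ~~ low_order H phi.
    by apply/negP => l; have := nh phi; rewrite mem_filter l phiG dh => /(_ isT).
  have phih : phi \in high_order_irr by rewrite mem_filter nl.
  have lti : (index phi high_order_irr < size high_order_irr)%N by rewrite index_mem.
  have phiE : hirr (Ordinal lti) = phi by rewrite /hirr nth_index.
  have : Ordinal lti \in hirr_divisors h by rewrite inE phiE.
  by rewrite e inE phiE.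
by apply/seteqP; split; apply: main.
Qed.

(* The profiles in [A] seen through the divisors of high order: a polynomial
   without divisors of low order has its profile in [A] iff its set of
   high-order divisors is one of these. *)
Definition profile_sets (A : set (N.-tuple nat)) (S : {set 'I_(size high_order_irr)}) : bool :=
  `[< exists g, [/\ forall phi, phi \in low_order_irr -> ~~ (phi %| g),
        hirr_divisors g = S & A (irr_divisor_profile N g)] >].

Lemma count_low_order_irr : (size low_order_irr <= H * H)%N.
Proof. by rewrite size_filter count_low_order. Qed.

End HighOrder.

Arguments hirr_divisors {F N H} g.

(** The reference sum does not involve [m], so two coefficient laws can be compared through it.
    Divisors of low order cost a union bound; without them the profile is a function of the set of
    high-order divisors, whose law is close to [truncated_law]. [y] is the parameter of Rankin's
    trick. *)
Lemma wprob_profile_close (R : realType) p (p_pr : prime p) n N H k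
    (m : 'I_n.+1 -> 'F_p -> R) (A : set (N.-tuple nat)) (eps beta Lam y : R)
    (x := fun i : 'I_(size (high_order_irr 'F_p N H)) => ((p ^ (size (hirr i)).-1)%:R)^-1 : R) :
  (forall i u, 0 <= m i u) -> 0 <= eps -> 0 <= beta -> 0 < y -> \sum_i x i <= Lam ->
  (forall T : {set 'I_(size (high_order_irr 'F_p N H))}, (#|T| <= k)%N ->
    `|wprob m (fun g => hirr_prod T %| g) - \prod_(i in T) x i| <= eps * \prod_(i in T) x i) ->
  (forall phi, phi \in low_order_irr 'F_p N H -> wprob m (fun g => phi %| g) <= beta) ->
  `|wprob m (fun g => `[< A (irr_divisor_profile N g) >]) -
    \sum_(S | profile_sets A S) truncated_law x k S| <=
  (H * H)%:R * beta + (eps * expR (2 * Lam) +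
     (1 + 3 ^+ k) * (1 + eps) * (y ^- k * expR (y * Lam))).
Proof.
move=> m0 eps0 beta0 y0 xL close betaP; pose goodS := @profile_sets 'F_p N H A.
have w0 c : 0 <= weight m c by exact: weight_ge0.
have x0 i : 0 <= x i by rewrite invr_ge0.
have := @truncated_law_close R _ _ (weight m)
  (fun c => hirr_divisors (coef_poly c)) x k eps w0 x0 eps0.
have close' (T : {set 'I_(size (high_order_irr 'F_p N H))}) : (#|T| <= k)%N ->
    `|\sum_c weight m c * (T \subset hirr_divisors (coef_poly c))%:R -
    \prod_(i in T) x i| <= eps * \prod_(i in T) x i.
  move=> Tk; have := close T Tk; congr (`|_ - _| <= _).
  by apply: eq_bigr => c _; rewrite /= hirr_prod_dvdp.
move=> /(_ close') tr.
set M := \sum_(S | profile_sets A S) truncated_law x k S.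
pose mid := \sum_(S | goodS S) \sum_c weight m c * (hirr_divisors (coef_poly c) == S)%:R.
apply: (le_trans (ler_distD mid _ _)); rewrite lerD //; last first.
  rewrite /mid /M -sumrB; apply: (le_trans (ler_norm_sum _ _ _)).
  apply: le_trans (le_trans tr _).
    rewrite [leRHS](bigID goodS) /= lerDl sumr_ge0 //.
  rewrite lerD //.
    rewrite ler_wpM2l //; apply: (le_trans (prod_1D_le _ x0)) => //.
    by rewrite ler_expR ler_wpM2l.
  rewrite ler_wpM2l ?mulr_ge0 ?addr_ge0 ?exprn_ge0 //.
  apply: (le_trans (sum_prod_card_le _ y0 x0)).
  by rewrite ler_wpM2l ?invr_ge0 ?exprn_ge0 ?ler_expR ?ler_wpM2l // ltW.
have midE : mid = \sum_c weight m c * (goodS (hirr_divisors (coef_poly c)))%:R.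
  rewrite /mid exchange_big /=; apply: eq_bigr => c _; rewrite -mulr_sumr; congr (_ * _).
  have [g|ng] := boolP (goodS _).
    rewrite (bigD1 (hirr_divisors (coef_poly c))) //= eqxx big1 ?addr0 // => S /andP[_ /negPf].
    by rewrite eq_sym => ->.
  by rewrite big1 // => S gS; case: eqP => // e; move: ng; rewrite e gS.
rewrite midE /wprob -sumrB.
apply: (@le_trans _ _ (\sum_c weight m c * \sum_(phi <- low_order_irr 'F_p N H) (phi %| coef_poly c)%R%:R)).
  apply: (le_trans (ler_norm_sum _ _ _)); apply: ler_sum => c _.
  rewrite -mulrBr normrM ger0_norm // ler_wpM2l //.
  set g := coef_poly c; have sum0 : 0 <= \sum_(phi <- low_order_irr 'F_p N H) (phi %| g)%R%:R :> R.
    by rewrite sumr_ge0.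
  have [[phi phil dphi]|nbad] := pselect (exists2 phi, phi \in low_order_irr 'F_p N H & phi %| g).
    apply: (@le_trans _ _ 1).
      by case: asboolP => _; case: (goodS _); rewrite /= ?subrr ?subr0 ?sub0r ?normrN ?normr1 ?normr0.
    by rewrite (big_rem _ phil) /= dphi lerDl sumr_ge0.
  have ng phi : phi \in low_order_irr 'F_p N H -> ~~ (phi %| g).
    by move=> h; apply/negP => d; apply: nbad; exists phi.
  suff -> : `[< A (irr_divisor_profile N g) >] = goodS (hirr_divisors g) by rewrite subrr normr0.
  apply/asboolP/asboolP => [Ag|[g' [ng' e Ag']]]; first by exists g.
  by rewrite (profile_eq ng ng' (esym e)).
under eq_bigr do rewrite mulr_sumr.
rewrite exchange_big /=.
apply: (@le_trans _ _ (\sum_(phi <- low_order_irr 'F_p N H) beta)).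
  by rewrite big_seq [leRHS]big_seq; apply: ler_sum => phi; exact: betaP.
rewrite big_const_seq count_predT iter_addr_0 -(mulr_natl beta).
by rewrite ler_wpM2r // ler_nat count_low_order_irr.
Qed.

(** * The two laws *)

Lemma expR1_le4 (R : realType) : expR 1 <= 4 :> R.
Proof.
have h : expR (1 / 2) <= 2 :> R.
  rewrite -[1 / 2]opprK expRN -[leRHS]invrK lef_pV2 ?posrE ?expR_gt0 ?invr_gt0 //.
  by apply: le_trans (expR_ge1Dx _); lra.
have -> : 1 = 1 / 2 + 1 / 2 :> R by field.
rewrite expRD; have := expR_ge0 (1 / 2 : R); nra.
Qed.

Lemma expR_nat_le (R : realType) k : expR k%:R <= (4 ^ k)%:R :> R.
Proof. by rewrite -[k%:R]mul1r expRM_natr natrX lerXn2r ?nnegrE ?expR_ge0 ?expR1_le4. Qed.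

Lemma expR_nat_ge (R : realType) k : (2 ^ k)%:R <= expR k%:R :> R.
Proof.
rewrite -[k%:R]mul1r expRM_natr natrX lerXn2r ?nnegrE ?expR_ge0 //.
by apply: le_trans (expR_ge1Dx _); rewrite lexx.
Qed.

(** Each dyadic block contributes at most [1]. *)
Lemma sum_inv_le (R : realFieldType) l : \sum_(1 <= i < 2 ^ l) i%:R^-1 <= l%:R :> R.
Proof.
elim: l => [|l IH]; first by rewrite expn0 big_geq.
rewrite (@big_cat_nat _ _ _ (2 ^ l)) /= ?expn_gt0 ?leq_exp2l // -natr1 lerD //.
apply: (@le_trans _ _ (\sum_(2 ^ l <= i < 2 ^ l.+1) (2 ^ l)%:R^-1)).
  rewrite big_nat_cond [leRHS]big_nat_cond; apply: ler_sum => i /andP[/andP[h _] _].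
  by rewrite lef_pV2 ?posrE ?ltr0n ?expn_gt0 ?ler_nat // (leq_trans _ h) // expn_gt0.
rewrite sumr_const_nat expnS mul2n -addnn addnK -(mulr_natl (2 ^ l)%:R^-1) divff //.
Qed.

Section Laws.
Variables (R : realType) (p : nat) (p_pr : prime p) (n N H : nat).
Local Notation F := 'F_p.
Let x := fun i : 'I_(size (high_order_irr F N H)) => ((p ^ (size (hirr i)).-1)%:R)^-1 : R.

Lemma prod_hirr_inv (T : {set 'I_(size (high_order_irr F N H))}) :
  \prod_(i in T) x i = (p ^ (size (hirr_prod T)).-1)%:R^-1.
Proof. by rewrite hirr_prod_size expn_sum natr_prod prodfV. Qed.

Lemma sum_hirr_inv_le l : (N < 2 ^ l)%N -> \sum_i x i <= l%:R.
Proof.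
move=> Nl; rewrite /x (sum_hirr N H (fun phi : {poly F} => (p ^ (size phi).-1)%:R^-1)).
apply: (@le_trans _ _ (\sum_(phi <- irreducibles F N) (p ^ (size phi).-1)%:R^-1)).
  rewrite /high_order_irr big_filter [leRHS](bigID (low_order H)) /= lerDr sumr_ge0 //.
have := sum_irreducibles_inv R F N; rewrite card_Fp // => /le_trans; apply.
apply: le_trans (sum_inv_le R l).
rewrite [leRHS](@big_cat_nat _ _ _ N.+1) //= lerDl sumr_ge0 //.
Qed.

Lemma wprob_dvdp_close (m : 'I_n.+1 -> F -> R) (eps : R) (D : {poly F}) : D != 0 ->
  `|(p ^ (size D).-1)%:R * wprob m (fun g => D %| g) - 1| <= eps ->
  `|wprob m (fun g => D %| g) - (p ^ (size D).-1)%:R^-1| <= eps * (p ^ (size D).-1)%:R^-1.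
Proof.
move=> nzD; set q : R := (p ^ _)%:R; have q0 : 0 < q by rewrite ltr0n expn_gt0 prime_gt0.
move=> h; rewrite -(ler_pM2l q0) mulrCA divff ?gt_eqF // mulr1.
by rewrite -{1}(gtr0_norm q0) -normrM mulrBr divff ?gt_eqF.
Qed.

Lemma unif_hirr_close k (T : {set 'I_(size (high_order_irr F N H))}) :
  (N * k <= n)%N -> (#|T| <= k)%N ->
  `|wprob (@unif_monic R p n) (fun g => hirr_prod T %| g) - \prod_(i in T) x i| <=
    0 * \prod_(i in T) x i.
Proof.
move=> Nk Tk; have nzD : hirr_prod T != 0 by apply: monic_neq0; exact: hirr_prod_monic.
rewrite prod_hirr_inv; apply: wprob_dvdp_close => //.
rewrite wprob_unif_dvdp // ?subrr ?normr0 //.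
rewrite (leq_trans (leqSpred _)) // ltnS (leq_trans (hirr_prod_size_le T)) //.
by rewrite (leq_trans _ Nk) // leq_mul2l Tk orbT.
Qed.

Lemma unif_low_order_le (phi : {poly F}) : (N <= n)%N -> phi \in irreducibles F N ->
  wprob (@unif_monic R p n) (fun g => phi %| g) <= p%:R^-1.
Proof.
move=> Nn /mem_irreducibles[mf irr _ szf]; have nz := monic_neq0 mf.
have h := wprob_unif_dvdp R p_pr nz (leq_trans szf (Nn : N.+1 <= n.+1)%N).
have q0 : 0 < (p ^ (size phi).-1)%:R :> R by rewrite ltr0n expn_gt0 prime_gt0.
rewrite -(ler_pM2l q0) h ler_pdivlMr ?ltr0n ?prime_gt0 // mul1r ler_nat.
rewrite -{1}(expn1 p) leq_exp2l ?prime_gt1 //.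
by case: (size phi) irr.1 => [|[|s]].
Qed.

Lemma iid_low_order_le (mu : F -> R) (eta : R) (phi : {poly F}) :
  (forall u, 0 <= mu u) -> \sum_u mu u = 1 -> 0 < eta ->
  eta <= \sum_u \sum_(v | v != u) mu u * mu v -> phi \in irreducibles F N ->
  wprob (n := n) (fun=> mu) (fun g => phi %| g) <=
    p%:R^-1 + 4 / Num.sqrt (eta * n.+1%:R / 2).
Proof.
move=> mu0 mu1 eta0 eta_le phiI; apply: wprob_dvdp_le => //.
  by have /mem_irreducibles[mf _ _ _] := phiI; exact: monic_neq0.
by move=> j; exact: irreducible_ndvdXn phiI.
Qed.

End Laws.

(** [r] serves the pigeonhole bound [2 p^(deg D) < 2^r], [Q] is the bound of [many_primes] at
    [K = 2l], and [W] is the window of [window_relation_divisor] plus the [r] terms read by a shift.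
    [E] provides enough windows for [eta L >= 2r], whence the error
    [p^(deg D) exp (- 2r) <= 2^(- r)]. *)
Lemma iid_hirr_close (R : realType) p (p_pr : prime p) n N (mu : 'F_p -> R) (eta : R) E
    (l := up_log 2 n) (la := up_log 2 p) (r := (26 * N * l * la + 2)%N)
    (Q := (12 * r * l)%N) (W := (26 * N * l + 1 + la * (Q * r) + r)%N)
    (x := fun i : 'I_(size (high_order_irr 'F_p N Q)) => ((p ^ (size (hirr i)).-1)%:R)^-1 : R)
    (T : {set 'I_(size (high_order_irr 'F_p N Q))}) :
  (forall u, 0 <= mu u) -> \sum_u mu u = 1 -> 0 < eta ->
  eta <= \sum_u \sum_(v | v != u) mu u * mu v ->
  (1 < n)%N -> (0 < N)%N -> 64 <= E%:R * eta -> (E * r * l * W <= n)%N -> (0 < E)%N ->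
  (#|T| <= 26 * l)%N ->
  `|wprob (n := n) (fun=> mu) (fun g => hirr_prod T %| g) - \prod_(i in T) x i| <=
    (2 ^ r)%:R^-1 * \prod_(i in T) x i.
Proof.
move=> mu0 mu1 eta0 eta_le n_gt1 N_gt0 E64 leWn E_gt0 Tk.
have l_gt0 : (0 < l)%N by rewrite up_log_gt0.
have la_gt0 : (0 < la)%N by rewrite up_log_gt0 /= prime_gt1.
have nl : (n <= 2 ^ l)%N by exact: up_logP.
have pl : (p <= 2 ^ la)%N by exact: up_logP.
have r_gt0 : (0 < r)%N by rewrite /r addn2.
have W_gt0 : (0 < W)%N by rewrite /W addn1 !addSn.
have Wn : (W <= n)%N.
  by rewrite (leq_trans _ leWn) // leq_pmull // !muln_gt0 E_gt0 r_gt0.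
have QW : (Q <= W)%N.
  suff : (Q <= la * (Q * r))%N by rewrite /W; lia.
  by rewrite mulnCA leq_pmulr // muln_gt0 la_gt0.
have nzD : hirr_prod T != 0 by apply: monic_neq0; exact: hirr_prod_monic.
set D := hirr_prod T in nzD *.
have szD : ((size D).-1 <= 26 * N * l)%N.
  apply: leq_trans (hirr_prod_size_le T) _.
  by rewrite mulnAC mulnC [(26 * l * N)%N]mulnC -mulnC leq_mul2l Tk orbT.
have pe : (2 * p ^ (size D).-1 < 2 ^ r)%N.
  have : (p ^ (size D).-1 <= 2 ^ (26 * N * l * la))%N.
    apply: (leq_trans (leq_pexp2l (prime_gt0 p_pr) szD)).
    rewrite [(26 * N * l * la)%N]mulnC [X in (_ <= X)%N]expnM leq_exp2r //.
    by rewrite !muln_gt0 N_gt0.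
  rewrite /r expnD; have : (0 < 2 ^ (26 * N * l * la))%N by rewrite expn_gt0.
  move: (p ^ _)%N (2 ^ (26 * N * l * la))%N => a b; lia.
have [s [szs us sP]] : exists s : seq nat, [/\ size s = r, uniq s &
    forall q, q \in s -> [/\ prime q, (2 * r <= q)%N & (q <= Q)%N]].
  have [||s [h1 h2 h3]] := @many_primes r (2 * l) r_gt0.
  - by rewrite muln_gt0.
  - apply: leq_trans (_ : 2 ^ l <= _)%N; last by rewrite leq_exp2l //; lia.
    apply: leq_trans nl; apply: leq_trans Wn; apply: leq_trans QW.
    by rewrite /Q; lia.
  exists s; split=> // q /h3[? ? h]; split=> //.
  by rewrite (leq_trans h) // /Q; lia.
(* Makes [exp (- 1 / (8 tau)) = exp (- 4 l) <= n^(- 4)], which absorbs the union bound over [w <= n]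
   shifts. *)
pose tau : R := (32 * l%:R)^-1.
have lR : 0 < l%:R :> R by rewrite ltr0n.
have tau0 : 0 < tau by rewrite invr_gt0 mulr_gt0.
pose w := (26 * N * l + 1 + la * (Q * r))%N.
have WE : W = (w + r)%N by [].
have wtau : 4 * w%:R * expR (- (8 * tau)^-1) <= 1 :> R.
  have -> : (8 * tau)^-1 = (4 * l)%:R by rewrite /tau natrM; field; rewrite gt_eqF.
  rewrite expRN ler_pdivrMr ?expR_gt0 // mul1r.
  apply: le_trans (expR_nat_ge R _); rewrite -natrM ler_nat.
  have wn : (w <= n)%N by lia.
  apply: (@leq_trans (n ^ 4)); last by rewrite mulnC expnM leq_exp2r.
  apply: (@leq_trans (2 ^ 3 * n)); first by lia.
  by rewrite [(n ^ 4)%N]expnSr leq_mul2r leq_exp2r // n_gt1 orbT.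
pose L : R := ((n.+1 %/ W)%N)%:R * tau.
have L0 : 0 <= L by rewrite mulr_ge0 // ltW.
have LP : 2 * r%:R <= eta * L.
  have hE : (E * r * l <= n.+1 %/ W)%N by rewrite leq_divRL // (leq_trans leWn).
  have : (E * r * l)%:R * tau <= L by rewrite ler_wpM2r ?ler_nat // ltW.
  have -> : (E * r * l)%:R * tau = E%:R * r%:R / 32.
    by rewrite /tau !natrM; field; rewrite gt_eqF.
  move=> h; apply: le_trans (ler_wpM2l (ltW eta0) h).
  have : 64 * r%:R <= E%:R * eta * r%:R by rewrite ler_wpM2r.
  lra.
rewrite prod_hirr_inv //; apply: wprob_dvdp_close => //.
apply: (le_trans (wprob_good_dist p_pr mu0 mu1 L0 eta_le nzD _)).
  move=> b nb.
  apply: (@sum_ge_windows R (fun i => ((centered_lift (modp_functional b 'X^i))%:~R / p%:R) ^+ 2)) => [i|j].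
    exact: sqr_ge0.
  rewrite WE; apply/ltW.
  have h := @window_sum_gt R p (modp_functional b) D s r Q la j w tau.
  apply: h => //.
  - by move=> g; exact: modp_functional_mul.
  - by have [i ni bi] := modp_functional_neq0 nb; exists 'X^i; rewrite /= bi.
  - by move=> phi irr; exact: hirr_prod_good.
  - have szD0 : (0 < size D)%N by rewrite size_poly_gt0.
    by move: szD szD0; rewrite /w; move: (size D) => a; lia.
apply: (@le_trans _ _ ((2 ^ r)%:R * expR (- (2 * r%:R)))).
  apply: ler_pM; rewrite ?expR_ge0 ?ler_expR ?lerN2 // ler_nat.
  by rewrite (leq_trans _ (ltnW pe)) // leq_pmull.
rewrite -[leRHS]mul1r ler_pdivlMr ?ltr0n ?expn_gt0 // mulrAC expRN ler_pdivrMr ?expR_gt0 // mul1r.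
by rewrite -[leLHS]natrM -expnD addnn -mul2n -natrM expR_nat_ge.
Qed.

(** * Conclusion *)

(** The choice [y = 12 = 3 * 4] cancels [3^(26 l)], and [exp (24 l) <= 4^(24 l)] against [4^(26 l)]
    leaves [2^(- 4 l)]. *)
Lemma truncation_error_le (R : realType) l (eps : R) : 0 <= eps -> eps <= (2 ^ (26 * l))%:R^-1 ->
  eps * expR (2 * (2 * l)%:R) +
    (1 + 3 ^+ (26 * l)) * (1 + eps) * (12 ^- (26 * l) * expR (12 * (2 * l)%:R)) <=
  5 * (2 ^ (4 * l))%:R^-1.
Proof.
move=> eps0 eps_le.
have pw a b : 0 < (a.+1 ^ b)%:R :> R by rewrite ltr0n expn_gt0.
have eps1 : eps <= 1.
  by rewrite (le_trans eps_le) // invf_le1 // ler1n expn_gt0.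
have h1 : eps * expR (2 * (2 * l)%:R) <= (2 ^ (4 * l))%:R^-1.
  rewrite -natrM (_ : (2 * (2 * l) = 4 * l)%N); last lia.
  apply: le_trans (ler_pM eps0 (expR_ge0 _) eps_le (expR_nat_le R (4 * l))) _.
  rewrite mulrC ler_pdivrMr // mulrC ler_pdivlMr // -natrM ler_nat.
  rewrite -[4%N]/(2 ^ 2)%N -expnM -expnD leq_exp2l //; lia.
have h2 : (1 + 3 ^+ (26 * l)) * (1 + eps) <= 4 * 3 ^+ (26 * l).
  have : 1 <= 3 ^+ (26 * l) :> R by rewrite exprn_ege1 // ler1n.
  move: (3 ^+ (26 * l)) => t t1; nra.
have h3 : 12 ^- (26 * l) * expR (12 * (2 * l)%:R) <= 3 ^- (26 * l) * (2 ^ (4 * l))%:R^-1 :> R.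
  have -> : 12 * (2 * l)%:R = (24 * l)%:R :> R by rewrite -natrM; congr (_%:R); lia.
  have e12 : 12 = 3 * 4 :> R by rewrite -natrM.
  rewrite e12 exprMn invfM -mulrA ler_wpM2l ?invr_ge0 ?exprn_ge0 //.
  apply: le_trans (ler_wpM2l _ (expR_nat_le R (24 * l))) _; first by rewrite invr_ge0 exprn_ge0.
  rewrite -natrX mulrC ler_pdivrMr // mulrC ler_pdivlMr // -natrM ler_nat.
  rewrite -[4%N]/(2 ^ 2)%N -!expnM -expnD leq_exp2l //; lia.
have t0 : 0 < 3 ^+ (26 * l) :> R by rewrite exprn_gt0.
have h4 : (1 + 3 ^+ (26 * l)) * (1 + eps) * (12 ^- (26 * l) * expR (12 * (2 * l)%:R)) <=
    4 * (2 ^ (4 * l))%:R^-1.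
  apply: le_trans (ler_pM _ _ h2 h3) _.
  - by rewrite mulr_ge0 // addr_ge0 // exprn_ge0.
  - by rewrite mulr_ge0 ?expR_ge0 // invr_ge0 exprn_ge0.
  by rewrite mulrA -[4 * _ * _]mulrA divff ?gt_eqF // mulr1.
lra.
Qed.

Lemma up_log_le_ln (R : realType) n : (1 < n)%N -> (up_log 2 n)%:R <= 4 * ln n%:R :> R.
Proof.
move=> n_gt1; set l := up_log 2 n.
have n0 : 0 < n%:R :> R by rewrite ltr0n ltnW.
have ln2 : 1 / 2 <= ln 2 :> R.
  rewrite -[X in X <= _](expRK (1 / 2)) ler_ln ?posrE ?expR_gt0 //.
  rewrite -[1 / 2]opprK expRN -[leRHS]invrK lef_pV2 ?posrE ?expR_gt0 ?invr_gt0 //.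
  by apply: le_trans (expR_ge1Dx _); lra.
have h1 : ln 2 <= ln n%:R :> R by rewrite ler_ln ?posrE // ler_nat.
have h2 : l.-1%:R * ln 2 <= ln n%:R :> R.
  rewrite mulr_natl -lnXn // -natrX ler_ln ?posrE ?ltr0n ?expn_gt0 ?(ltnW n_gt1) // ler_nat.
  exact: ltnW (up_log_gtn _ n_gt1).
have l_gt0 : (0 < l)%N by rewrite up_log_gt0.
have hl : l%:R = l.-1%:R + 1 :> R by rewrite natr1 prednK.
rewrite hl; have : 0 <= l.-1%:R :> R by rewrite ler0n.
move: (l.-1%:R : R) h2 => t h2 t0; nra.
Qed.

(** The right side is the probability that two independent samples differ,
    [1 - \sum_u mu u ^+ 2]. *)
Lemma sum_offdiag_ge (R : realType) p (p_pr : prime p) (mu : 'F_p -> R) :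
  (forall u, 0 <= mu u) -> \sum_u mu u = 1 ->
  1 - \big[Order.max/0]_u mu u <= \sum_u \sum_(v | v != u) mu u * mu v.
Proof.
move=> mu0 mu1; set M := \big[_/_]_u _.
have muM u : mu u <= M by apply: le_bigmax.
rewrite [leRHS](eq_bigr (fun u => mu u - mu u * mu u)); last first.
  move=> u _; rewrite -mulr_sumr -[X in _ = X - _]mulr1 -mu1 [in RHS](bigD1 u) //=.
  by rewrite mulrDr addrAC subrr add0r.
rewrite sumrB mu1 lerD2l lerN2.
apply: (@le_trans _ _ (\sum_u mu u * M)); first by apply: ler_sum => u _; rewrite ler_wpM2l.
by rewrite -mulr_suml mu1 mul1r.
Qed.

Lemma wprob_ge0_le1 (R : realType) p n (m : 'I_n.+1 -> 'F_p -> R) B :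
  (forall i u, 0 <= m i u) -> (forall i, \sum_u m i u = 1) -> 0 <= wprob m B <= 1.
Proof.
move=> m0 m1; rewrite sumr_ge0 /= => [|c _]; last by rewrite mulr_ge0 ?weight_ge0.
rewrite -(sum_weight m1); apply: ler_sum => c _.
by rewrite -[leRHS]mulr1 ler_wpM2l ?weight_ge0 // lern1 leq_b1.
Qed.

Lemma profile_law_dist (R : realType) p (p_pr : prime p) n N (mu : 'F_p -> R) (eta : R) E
    (A : set (N.-tuple nat))
    (l := up_log 2 n) (la := up_log 2 p) :
  (forall u, 0 <= mu u) -> \sum_u mu u = 1 -> 0 < eta ->
  eta <= \sum_u \sum_(v | v != u) mu u * mu v ->
  (1 < n)%N -> (0 < N)%N -> 64 <= E%:R * eta -> (0 < E)%N ->
  (14 * 28 ^ 3 * E * (N ^ 4 * l ^ 8 * la ^ 4) <= n)%N ->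
  `|wprob (n := n) (fun=> mu) (fun g => `[< A (irr_divisor_profile N g) >]) -
    wprob (@unif_monic R p n) (fun g => `[< A (irr_divisor_profile N g) >])| <=
  (336 ^ 2 * (N ^ 2 * l ^ 4 * la ^ 2))%:R * (2 / p%:R + 4 / Num.sqrt (eta * n.+1%:R / 2)) +
  10 * (2 ^ (4 * l))%:R^-1.
Proof.
move=> mu0 mu1 eta0 eta_le n_gt1 N_gt0 E64 E_gt0 nbig.
have l_gt0 : (0 < l)%N by rewrite up_log_gt0.
have la_gt0 : (0 < la)%N by rewrite up_log_gt0 /= prime_gt1.
pose r := (26 * N * l * la + 2)%N; pose Q := (12 * r * l)%N.
pose W := (26 * N * l + 1 + la * (Q * r) + r)%N.
have r_le : (r <= 28 * (N * l * la))%N.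
  have : (0 < N * l * la)%N by rewrite !muln_gt0 N_gt0 l_gt0.
  by rewrite /r; lia.
have W_le : (W <= 14 * (la * r ^ 2 * l))%N.
  have h1 : (26 * N * l + 1 <= r)%N.
    have : (26 * N * l <= 26 * N * l * la)%N by rewrite leq_pmulr.
    by rewrite /r; lia.
  have h2 : (r <= la * r ^ 2 * l)%N.
    have r_gt0 : (0 < r)%N by rewrite /r addn2.
    by rewrite expnS expn1 mulnAC mulnA leq_pmull // !muln_gt0 la_gt0 l_gt0 r_gt0.
  by rewrite /W /Q; lia.
have leWn : (E * r * l * W <= n)%N.
  apply: leq_trans nbig.
  apply: (@leq_trans (E * r * l * (14 * (la * r ^ 2 * l)))); first by rewrite leq_mul2l W_le orbT.
  have -> : (E * r * l * (14 * (la * r ^ 2 * l)) = 14 * E * (la * l ^ 2) * r ^ 3)%N by ring.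
  apply: (@leq_trans (14 * E * (la * l ^ 2) * (28 * (N * l * la)) ^ 3)).
    by rewrite leq_mul2l leq_exp2r ?r_le ?orbT.
  have -> : (14 * E * (la * l ^ 2) * (28 * (N * l * la)) ^ 3 =
     14 * 28 ^ 3 * E * (N ^ 3 * l ^ 5 * la ^ 4))%N by ring.
  (* Enlarging [N^3 l^5] to [N^4 l^8] makes the threshold a multiple of the square of
     [N^2 l^4 la^2]. *)
  rewrite leq_mul2l; apply/orP; right; rewrite leq_mul2r; apply/orP; right.
  by rewrite leq_mul // leq_pexp2l.
have Wn : (W <= n)%N.
  by rewrite (leq_trans _ leWn) // leq_pmull // !muln_gt0 E_gt0 l_gt0 /r addn2.
have Nkn : (N * (26 * l) <= n)%N.
  by apply: leq_trans Wn; rewrite /W; lia.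
have Nn : (N <= n)%N by apply: leq_trans Nkn; rewrite leq_pmulr // muln_gt0.
have nl : (n <= 2 ^ l)%N by exact: up_logP.
have sumx : \sum_i ((p ^ (size (@hirr 'F_p N Q i)).-1)%:R)^-1 <= (2 * l)%:R :> R.
  apply: (le_trans (@sum_hirr_inv_le R p p_pr N Q l.+1 _)); last by rewrite ler_nat; lia.
  have h2 : (0 < 2 ^ l)%N by rewrite expn_gt0.
  by rewrite expnS mul2n -addnn; lia.
set B1 := p%:R^-1 + 4 / Num.sqrt (eta * n.+1%:R / 2).
have sq0 : 0 <= 4 / Num.sqrt (eta * n.+1%:R / 2) :> R by rewrite divr_ge0 // sqrtr_ge0.
have p0 : 0 <= p%:R^-1 :> R by rewrite invr_ge0.
have B10 : 0 <= B1 by rewrite addr_ge0.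
have eps0 : 0 <= (2 ^ r)%:R^-1 :> R by rewrite invr_ge0.
have eps_le : (2 ^ r)%:R^-1 <= (2 ^ (26 * l))%:R^-1 :> R.
  rewrite lef_pV2 ?posrE ?ltr0n ?expn_gt0 // ler_nat leq_exp2l //.
  rewrite /r (leq_trans _ (leq_addr _ _)) // -mulnA -mulnA leq_mul2l /=.
  by rewrite mulnCA leq_pmulr // muln_gt0 N_gt0 la_gt0.
have low_mem phi : phi \in low_order_irr 'F_p N Q -> phi \in irreducibles 'F_p N.
  by rewrite mem_filter => /andP[].
have c1 := @wprob_profile_close R p p_pr n N Q (26 * l) (fun=> mu) A (2 ^ r)%:R^-1 B1 (2 * l)%:R 12
  (fun=> mu0) eps0 B10 (ltr0n _ _) sumx
  (fun T => @iid_hirr_close R p p_pr n N mu eta E T mu0 mu1 eta0 eta_le n_gt1 N_gt0 E64 leWn E_gt0)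
  (fun phi h => @iid_low_order_le R p p_pr n N mu eta phi mu0 mu1 eta0 eta_le (low_mem phi h)).
have c2 := @wprob_profile_close R p p_pr n N Q (26 * l) (@unif_monic R p n) A 0 p%:R^-1 (2 * l)%:R 12
  (@unif_monic_ge0 R p n) (lexx 0) p0 (ltr0n _ _) sumx
  (fun T => @unif_hirr_close R p p_pr n N Q (26 * l) T Nkn)
  (fun phi h => unif_low_order_le R p_pr Nn (low_mem phi h)).
have e1 := truncation_error_le eps0 eps_le.
have e2 := truncation_error_le (lexx (0 : R)) (le_trans eps0 eps_le).
set M := \sum_(S | _) _ in c1 c2.
apply: le_trans (ler_distD M _ _) _; rewrite [X in _ + X]distrC.
apply: le_trans (lerD c1 c2) _.
have QQ : (Q * Q)%:R <= (336 ^ 2 * (N ^ 2 * l ^ 4 * la ^ 2))%:R :> R.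
  rewrite ler_nat; have -> : (336 ^ 2 * (N ^ 2 * l ^ 4 * la ^ 2) = (336 * (N * l ^ 2 * la)) ^ 2)%N by ring.
  rewrite mulnn leq_exp2r // /Q.
  apply: (@leq_trans (12 * (28 * (N * l * la)) * l)); first by rewrite leq_mul2r leq_mul2l r_le !orbT.
  by rewrite leq_eqVlt; apply/orP; left; apply/eqP; ring.
have : (Q * Q)%:R * (B1 + p%:R^-1) <= (336 ^ 2 * (N ^ 2 * l ^ 4 * la ^ 2))%:R * (B1 + p%:R^-1).
  by rewrite ler_wpM2r // addr_ge0.
have -> : B1 + p%:R^-1 = 2 / p%:R + 4 / Num.sqrt (eta * n.+1%:R / 2) by rewrite /B1; ring.
move=> h; move: e1 e2; set t1 := (X in X <= _ -> _); set t2 := (X in _ -> X <= _ -> _) => e1 e2.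
have -> : (Q * Q)%:R * B1 + t1 + ((Q * Q)%:R * p%:R^-1 + t2) =
  (Q * Q)%:R * (2 / p%:R + 4 / Num.sqrt (eta * n.+1%:R / 2)) + (t1 + t2) by rewrite /B1; ring.
apply: lerD h _; lra.
Qed.

Lemma sum_prob_singletons (R : realType) p (mu : probability 'F_p R) :
  \sum_u fine (mu [set u]%classic) = 1.
Proof.
have fin u : (fine (mu [set u]%classic))%:E = mu [set u]%classic.
  by rewrite fineK // fin_num_measure.
suff : (\sum_u fine (mu [set u]%classic))%:E = (1 : R)%:E by case.
rewrite -sumEFin (eq_bigr (fun u => mu [set u]%classic)) => [|u _]; last exact: fin.
rewrite -(probability_setT mu).
have -> : [set: 'F_p]%classic = (\big[setU/set0]_(u : 'F_p | xpredT u) [set u])%classic.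
  rewrite -(bigcup_pred predT); apply/seteqP; split=> u //= _.
  by exists u.
rewrite measure_bigsetU_ord //.
by move=> u v _ _ [z [/= -> ->]].
Qed.

(** Above the threshold [profile_law_dist] applies. Below it [n] is at most a constant times [Z^2],
    so [Z / sqrt n] is bounded below and the trivial bound [dist <= 1] is enough. *)
Lemma profile_law_dist_le (R : realType) p (p_pr : prime p) n N (mu : 'F_p -> R) (eta : R) E
    (A : set (N.-tuple nat))
    (X := N%:R ^+ 2 * ln n%:R ^+ 4 * ln p%:R ^+ 2 : R)
    (C := 4 ^+ 6 * ((14 * 28 ^ 3 * E)%:R + 336 ^+ 2 * (2 + 4 * Num.sqrt (2 / eta)) + 10)) :
  (forall u, 0 <= mu u) -> \sum_u mu u = 1 -> 0 < eta ->
  eta <= \sum_u \sum_(v | v != u) mu u * mu v ->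
  (1 < n)%N -> (0 < N)%N -> 64 <= E%:R * eta -> (0 < E)%N ->
  `|wprob (n := n) (fun=> mu) (fun g => `[< A (irr_divisor_profile N g) >]) -
    wprob (@unif_monic R p n) (fun g => `[< A (irr_divisor_profile N g) >])| <=
  C * (p%:R^-1 + (Num.sqrt n%:R)^-1) * X.
Proof.
move=> mu0 mu1 eta0 eta_le n_gt1 N_gt0 E64 E_gt0.
set dist := `|_|; pose l := up_log 2 n; pose la := up_log 2 p.
have l_gt0 : (0 < l)%N by rewrite up_log_gt0.
have la_gt0 : (0 < la)%N by rewrite up_log_gt0 /= prime_gt1.
pose Z : R := (N ^ 2 * l ^ 4 * la ^ 2)%:R.
have Z1 : 1 <= Z by rewrite ler1n (muln_gt0 (N ^ 2 * l ^ 4)) (muln_gt0 (N ^ 2)) !expn_gt0 N_gt0 l_gt0 la_gt0.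
(* One factor [4] from [up_log_le_ln] for each of the six logarithms. *)
have ZX : Z <= 4 ^+ 6 * X.
  have -> : 4 ^+ 6 * X = N%:R ^+ 2 * (4 * ln n%:R) ^+ 4 * (4 * ln p%:R) ^+ 2 by rewrite /X; ring.
  have -> : Z = N%:R ^+ 2 * l%:R ^+ 4 * la%:R ^+ 2 by rewrite -!natrX -!natrM.
  have hl := up_log_le_ln R n_gt1; have hla := up_log_le_ln R (prime_gt1 p_pr).
  apply: ler_pM; rewrite ?mulr_ge0 ?exprn_ge0 //.
    by apply: ler_pM; rewrite ?exprn_ge0 // lerXn2r ?nnegrE // (le_trans _ hl).
  by rewrite lerXn2r ?nnegrE // (le_trans _ hla).
pose s : R := (Num.sqrt n%:R)^-1.
have n0 : 0 < n%:R :> R by rewrite ltr0n ltnW.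
have sq0 : 0 < Num.sqrt n%:R :> R by rewrite sqrtr_gt0.
have s0 : 0 < s by rewrite invr_gt0.
have p0 : 0 < p%:R^-1 :> R by rewrite invr_gt0 ltr0n prime_gt0.
have se0 : 0 <= Num.sqrt (2 / eta) by exact: sqrtr_ge0.
pose C1 : R := (14 * 28 ^ 3 * E)%:R; have C10 : 0 <= C1 by rewrite ler0n.
pose C2 : R := 336 ^+ 2 * (2 + 4 * Num.sqrt (2 / eta)) + 10.
have C20 : 0 <= C2 by rewrite addr_ge0 // mulr_ge0 ?exprn_ge0 // addr_ge0 // mulr_ge0.
suff main : dist <= (C1 + C2) * (p%:R^-1 + s) * Z.
  apply: (le_trans main).
  have -> : C * (p%:R^-1 + (Num.sqrt n%:R)^-1) * X = (C1 + C2) * (p%:R^-1 + s) * (4 ^+ 6 * X).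
    by rewrite /C /s /C1 /C2; ring.
  by rewrite ler_wpM2l // mulr_ge0 ?addr_ge0 // ltW.
have [nbig|nsmall] := leqP (14 * 28 ^ 3 * E * (N ^ 4 * l ^ 8 * la ^ 4)) n.
- apply: le_trans (profile_law_dist p_pr A mu0 mu1 eta0 eta_le n_gt1 N_gt0 E64 E_gt0 nbig) _.
  rewrite -/l -/la natrM -/Z natrX.
  have h1 : 4 / Num.sqrt (eta * n.+1%:R / 2) <= 4 * Num.sqrt (2 / eta) * s.
    have e0 : 0 <= 2 / eta by rewrite divr_ge0 // ltW.
    have e1 : 0 <= eta * n.+1%:R / 2 by rewrite divr_ge0 // mulr_ge0 // ltW.
    rewrite -[4 * _ * s]mulrA ler_wpM2l // /s -(sqrtrV (ler0n _ n)) -(sqrtrM _ e0) -(sqrtrV e1).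
    rewrite ler_sqrt; last by rewrite mulr_ge0 // invr_ge0.
    have -> : 2 / eta * n%:R^-1 = (eta * n%:R / 2)^-1 by field; rewrite !gt_eqF.
    have p1 : 0 < eta * n%:R / 2 by rewrite divr_gt0 // mulr_gt0.
    have p2 : eta * n%:R / 2 <= eta * n.+1%:R / 2.
      by rewrite -!mulrA ler_pM2l // ler_pM2r ?invr_gt0 // ler_nat.
    by rewrite lef_pV2 ?posrE // (lt_le_trans p1).
  have h2 : (2 ^ (4 * l))%:R^-1 <= s.
    rewrite /s lef_pV2 ?posrE ?ltr0n ?expn_gt0 //.
    apply: (@le_trans _ _ n%:R).
      rewrite -[X in _ <= X]sqr_sqrtr ?ler0n // expr2 -[X in X <= _]mulr1 ler_pM2l //.
      by rewrite -[X in X <= _]sqrtr1 ler_sqrt ?ler0n // ler1n ltnW.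
    rewrite ler_nat (leq_trans (up_logP n (isT : 1 < 2)%N)) // leq_exp2l //.
    by rewrite -/l leq_pmull.
  have a1 : 336 ^+ 2 * Z * (2 / p%:R + 4 / Num.sqrt (eta * n.+1%:R / 2)) <=
      336 ^+ 2 * Z * (2 / p%:R + 4 * Num.sqrt (2 / eta) * s).
    by rewrite ler_wpM2l ?lerD2l // mulr_ge0 ?exprn_ge0 // (le_trans _ Z1).
  have a2 : 10 * (2 ^ (4 * l))%:R^-1 <= 10 * s * Z.
    by rewrite -mulrA ler_wpM2l // (le_trans h2) // -[X in X <= _]mulr1 ler_wpM2l // ltW.
  apply: (le_trans (lerD a1 a2)).
  have -> : 336 ^+ 2 * Z * (2 / p%:R + 4 * Num.sqrt (2 / eta) * s) + 10 * s * Z =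
      (336 ^+ 2 * (2 * p%:R^-1 + 4 * Num.sqrt (2 / eta) * s) + 10 * s) * Z by ring.
  apply: ler_wpM2r; first by rewrite (le_trans _ Z1).
  have b1 : 0 <= C1 * (p%:R^-1 + s) by rewrite mulr_ge0 // addr_ge0 // ltW.
  have b2 : 0 <= 10 * p%:R^-1 :> R by rewrite mulr_ge0 // ltW.
  have b3 : 0 <= 336 ^+ 2 * (2 * s) by rewrite mulr_ge0 ?exprn_ge0 // mulr_ge0 // ltW.
  have b4 : 0 <= 336 ^+ 2 * (4 * Num.sqrt (2 / eta) * p%:R^-1).
    by rewrite mulr_ge0 ?exprn_ge0 // mulr_ge0 ?mulr_ge0 // ltW.
  have -> : (C1 + C2) * (p%:R^-1 + s) = C1 * (p%:R^-1 + s) + 10 * p%:R^-1 +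
     336 ^+ 2 * (2 * s) + 336 ^+ 2 * (4 * Num.sqrt (2 / eta) * p%:R^-1) +
     (336 ^+ 2 * (2 * p%:R^-1 + 4 * Num.sqrt (2 / eta) * s) + 10 * s).
    by rewrite /C2; ring.
  lra.
have dist1 : dist <= 1.
  have /andP[a0 a1] := wprob_ge0_le1 (fun g => `[< A (irr_divisor_profile N g) >])
    (fun _ : 'I_n.+1 => mu0) (fun _ => mu1).
  have /andP[b0 b1] := wprob_ge0_le1 (fun g => `[< A (irr_divisor_profile N g) >])
    (@unif_monic_ge0 R p n) (unif_monic_sum R p_pr (n := n)).
  rewrite /dist ler_norml; apply/andP; split; lra.
apply: (le_trans dist1).
have h : 1 <= C1 * s * Z.
  rewrite /s mulrAC ler_pdivlMr // mul1r.
  have CZ0 : 0 <= C1 * Z by rewrite mulr_ge0 // (le_trans _ Z1).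
  rewrite -[X in _ <= X]ger0_norm // -sqrtr_sqr ler_sqrt ?sqr_ge0 //.
  have -> : (C1 * Z) ^+ 2 = ((14 * 28 ^ 3 * E) ^ 2 * (N ^ 4 * l ^ 8 * la ^ 4))%:R.
    rewrite /C1 /Z -natrM -natrX; congr (_%:R); ring.
  rewrite ler_nat (leq_trans (ltnW nsmall)) // leq_mul2r; apply/orP; right.
  by rewrite -[X in (X <= _)%N]expn1 leq_pexp2l // !muln_gt0 E_gt0.
apply: (le_trans h); apply: ler_wpM2r; first by rewrite (le_trans _ Z1).
have b1 : 0 <= C1 * p%:R^-1 by rewrite mulr_ge0 // ltW.
have b2 : 0 <= C2 * (p%:R^-1 + s) by rewrite mulr_ge0 // addr_ge0 // ltW.
by rewrite mulrDl mulrDr; lra.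
Qed.

Local Open Scope classical_set_scope.

Theorem theorem7p2 (R : realType) (eta0 : R) (eta0_gt0 : 0 < eta0) :
  exists A : R,
  forall (p : nat) (p_prime : prime p)
    (n N : nat) (n_ge2 : (2 <= n)%N) (N_ge1 : (1 <= N)%N)
    (mu : probability 'F_p R)
    (mu_eta : 1 - \big[Order.max/0]_(x : 'F_p) fine (mu [set x]) = eta0)
    (d : measure_display) (T : measurableType d) (P : probability T R)
    (eps : 'I_n.+1 -> {RV P >-> 'F_p})
    (eps_indep : mutually_independent eps)
    (eps_mu : forall i, distribution P (eps i) = mu :> (set 'F_p -> \bar R))
    (d' : measure_display) (T' : measurableType d') (Q : probability T' R)
    (fbar : {RV Q >-> {poly 'F_p}})
    (fbar_unif : uniformly_distributed fbar (@monic_of_degree 'F_p n)),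
  let f : T -> {poly 'F_p} := fun w => \sum_(i < n.+1) eps i w *: 'X^i in
  (dTV (pushforward P (irr_divisor_profile N \o f))
       (pushforward Q (irr_divisor_profile N \o fbar))
   <= (A * (p%:R^-1 + n%:R `^ (- 2^-1)) * N%:R ^+ 2
         * ln n%:R ^+ 4 * ln p%:R ^+ 2)%:E)%E.
Proof.
(* The only choice behind the final constant; it depends on [eta0] alone. *)
pose E := Num.bound (64 / eta0).
have E64 : 64 <= E%:R * eta0.
  by rewrite -ler_pdivrMr // ltW // archi_boundP // divr_ge0 // ltW.
have E_gt0 : (0 < E)%N.
  by rewrite lt0n; apply: contraTneq E64 => ->; rewrite mul0r -ltNge.
exists (4 ^+ 6 * ((14 * 28 ^ 3 * E)%:R + 336 ^+ 2 * (2 + 4 * Num.sqrt (2 / eta0)) + 10)).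
move=> p p_prime n N n_ge2 N_ge1 mu mu_eta d T P eps eps_indep eps_mu d' T' Q fbar fbar_unif.
lazy zeta; set f : T -> {poly 'F_p} := fun w => _.
pose m u := fine (mu [set u]).
have m0 u : 0 <= m u by apply: fine_ge0.
have m1 : \sum_u m u = 1 := sum_prob_singletons mu.
have eta_le : eta0 <= \sum_u \sum_(v | v != u) m u * m v.
  by rewrite -mu_eta; exact: sum_offdiag_ge.
apply: ub_ereal_sup => _ [A _ <-].
have -> : pushforward P (irr_divisor_profile N \o f) A =
    P (f @^-1` (irr_divisor_profile N @^-1` A)) by [].
have -> : pushforward Q (irr_divisor_profile N \o fbar) A =
    Q (fbar @^-1` (irr_divisor_profile N @^-1` A)) by [].
rewrite (prob_iid_poly _ eps_indep eps_mu) (prob_unif_poly p_prime _ fbar_unif).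
rewrite -EFinB abse_EFin lee_fin powRN powR12_sqrt // -!mulrA mulrA mulrA.
have := profile_law_dist_le p_prime A m0 m1 eta0_gt0 eta_le n_ge2 N_ge1 E64 E_gt0.
by rewrite -!mulrA.
Qed.
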